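(* Let $\Delta\subset M_{\mathbb R}$ be a reflexive polytope, $\mathcal T$ a triangulation of $\Delta$ with vertex set $\{\mathbf 0\}\cup\{v_1,\ldots,v_n\}$ all of whose maximal simplices contain $\mathbf 0$, and $\Sigma$, $\mathbf v_i$, $K$, $\Psi$, $\int_{\mathcal A}$, $V(J)$ as in the context. Then $$\sum_{J\subseteq\{0,\ldots,n\},\ |J|=d+1}V(J)^2\Big(\prod_{i\in J}a_i\Big)\int_{\mathcal A}\Psi_{\sum_{i\in J}\mathbf v_i-\mathbf v_0}=\mathrm{Vol}(\Delta),$$ where $a_0=1$ and $\mathrm{Vol}(\Delta)$ is the normalized volume of $\Delta$ ($d!$ times its Euclidean volume with respect to $M$).
   Context: $M\cong\mathbb Z^d$ is a lattice with dual $N$. $\Delta$ is reflexive: a lattice polytope with $\mathbf 0$ in its interior whose polar is also a lattice polytope. The points $v_1,\ldots,v_n\in M$ lie on the boundary of $\Delta$ and include all vertices of $\Delta$. $\Sigma$ is the complete simplicial fan in $M_{\mathbb R}$ formed by the cones over the simplices of $\mathcal T$ not containing $\mathbf 0$ (its rays are generated by $v_1,\ldots,v_n$). For $k\ge0$, $A_k$ is the quotient of $\mathbb C[D_1,\ldots,D_n]$ by the linear elements $\sum_i(\lambda\cdot v_i)D_i$ ($\lambda\in N$) and the monomials $\prod_iD_i^{r_i}$ such that no cone of $\Sigma$ contains all $v_i$ with $r_i>k$. $A_k\cong H^*(\mathbb P_{\Sigma_k},\mathbb C)$, where $\Sigma_k$ is the complete simplicial fan in $M\oplus\mathbb Z^{nk}$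 with rays $v_{i,j}=v_i\oplus e_{i,j}$ ($0\le j\le k$; $e_{i,j}$, $j\ge1$, a basis of $\mathbb Z^{nk}$, $e_{i,0}=-\sum_{j\ge1}e_{i,j}$) whose cones are generated by sets $\{v_{i,j}:(i,j)\in I\}$ such that the $v_i$ with $(i,0),\ldots,(i,k)\in I$ lie in a cone of $\Sigma$; the isomorphism sends $D_i$ to $(k+1)D_{i,0}$, $D_{i,j}$ the divisor class of ray $v_{i,j}$. Define $\int_{A_k}=(k+1)^{-nk}\int_{\mathbb P_{\Sigma_k}}$ (top-degree evaluation). $\mathcal A$ is the direct limit of the $A_k$ under multiplication by $\prod_iD_i^l:A_k\to A_{k+l}$, and $\int_{\mathcal A}$ is the induced map (well defined since $\int_{A_k}a=\int_{A_{k+l}}a\prod_iD_i^l$). Put $D_0=-\sum_iD_i$, $\bar M=M\oplus\mathbb Z$, $\mathbf v_i=v_i\oplus1$, $\mathbf v_0=\mathbf 0\oplus1$, $K$ the cone spanned by $\mathbf v_0,\ldots,\mathbf v_n$. For $\beta=(b_0,\ldots,b_n)\in\mathbb Z^{n+1}$ with $b_0\le0$, $\Phi_\beta\in\mathcal A$ is the image of $D_0^{-b_0}\prod_{i=1}^nD_i^{k-b_i}\in A_k$, $k\ge\max b_i$. For $\mathbf p=p\oplus d\in K\cap\bar M$, $\int_{\mathcal A}\Psi_{\mathbf p}=\sum_{\beta:\sum_{i=0}^nb_i\mathbf v_i=-\mathbf p,\ b_0\le0}\big(\int_{\mathcal A}\Phi_\beta\big)\prod_{i=1}^na_i^{b_i}$,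 a formal Laurent series in $a_1,\ldots,a_n$. $V(J)$ is the normalized $(d+1)$-dimensional volume of the simplex spanned by $\mathbf v_i$, $i\in J$ (the absolute value of their determinant with respect to a basis of $\bar M$); terms with $V(J)=0$ are omitted, and when $V(J)\ne0$ the point $\sum_{i\in J}\mathbf v_i-\mathbf v_0$ lies in $K$. *)

(* Defs.v *)
From HB Require Import structures.
From mathcomp Require Import all_boot all_order all_algebra.
From mathcomp Require Import mpoly.

Set Implicit Arguments.
Unset Strict Implicit.
Unset Printing Implicit Defensive.

Import Order.TTheory GRing.Theory Num.Theory.
Local Open Scope ring_scope.

Definition ratv (d : nat) (x : 'rV[int]_d) : 'rV[rat]_d := map_mx intr x.

Definition in_conv (d r : nat) (w : 'I_r -> 'rV[rat]_d) (x : 'rV[rat]_d) : Prop :=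
  exists t : 'I_r -> rat,
    [/\ forall i, 0 <= t i, \sum_i t i = 1 & x = \sum_i t i *: w i].

Definition in_Delta (d n : nat) (v : 'I_n -> 'rV[int]_d) (x : 'rV[rat]_d) : Prop :=
  in_conv (fun i => ratv (v i)) x.

Definition interior_pt (d : nat) (P : 'rV[rat]_d -> Prop) (x : 'rV[rat]_d) : Prop :=
  exists2 eps : rat, 0 < eps &
    forall y : 'rV[rat]_d, (forall c, `|y 0 c - x 0 c| < eps) -> P y.

Definition pairing (d : nat) (u x : 'rV[rat]_d) : rat := \sum_c u 0 c * x 0 c.

Definition reflexive_polytope (d n : nat) (v : 'I_n -> 'rV[int]_d) : Prop :=
  interior_pt (in_Delta v) 0 /\
  exists (r : nat) (w : 'I_r -> 'rV[int]_d),
    forall u : 'rV[rat]_d,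
      (forall x, in_Delta v x -> -1 <= pairing u x) <-> in_conv (fun i => ratv (w i)) u.

Definition in_simplex0 (d n : nat) (v : 'I_n -> 'rV[int]_d) (S : {set 'I_n})
    (x : 'rV[rat]_d) : Prop :=
  exists t : 'I_n -> rat,
    [/\ forall i, 0 <= t i, forall i, i \notin S -> t i = 0,
        \sum_i t i <= 1 & x = \sum_i t i *: ratv (v i)].

Definition rows_mx (d n : nat) (v : 'I_n -> 'rV[int]_d) (S : {set 'I_n}) : 'M[int]_d :=
  \matrix_(a < d, c < d) (nth 0 [seq v i | i <- enum S] a) 0 c.

(* T is the set of maximal simplices of a triangulation of Delta with vertex
   set {0} U {v_1..v_n}, all maximal simplices containing 0; a maximal simplex
   conv({0} U {v_i : i in S}) is recorded by S. *)
Definition triangulation (d n : nat) (v : 'I_n -> 'rV[int]_d) (T : {set {set 'I_n}}) : Prop :=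
  [/\
      forall S, S \in T -> #|S| = d /\ \det (rows_mx v S) != 0,
      forall x, in_Delta v x -> exists2 S, S \in T & in_simplex0 v S x,
      forall S S' x, S \in T -> S' \in T -> in_simplex0 v S x -> in_simplex0 v S' x ->
        in_simplex0 v (S :&: S') x
    &
      forall i, exists2 S, S \in T & i \in S].

(* monomials in the ray variables x_r are exponent functions *)
Definition mdeg_f (Ray : finType) (m : {ffun Ray -> nat}) : nat := (\sum_r m r)%N.
Definition msupp_f (Ray : finType) (m : {ffun Ray -> nat}) : {set Ray} :=
  [set r | m r != 0%N].
Definition mmulX (Ray : finType) (m : {ffun Ray -> nat}) (r : Ray) : {ffun Ray -> nat} :=
  [ffun r' => (m r' + (r' == r))%N].
Definition mind (Ray : finType) (I : {set Ray}) : {ffun Ray -> nat} :=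
  [ffun r => nat_of_bool (r \in I)].

(* multiplicity |det(u_r : r in I)| of a full-dimensional simplicial cone;
   coordinates of the ambient lattice are indexed by the finType C *)
Definition cone_mult (C Ray : finType) (u : Ray -> C -> int) (I : {set Ray}) : int :=
  `|\det (\matrix_(a < #|C|, b < #|C|)
            (nth (fun _ => 0) [seq u r | r <- enum I] a) (enum_val b))|.

(* f : monomials -> Q is the top-degree evaluation  int_{P_Sigma}  of the
   cohomology ring H^*(P_Sigma) = Q[x_r] / (Stanley-Reisner + linear relations)
   of the complete simplicial fan Sigma with rays u_r and cones given by
   [is_cone]: f vanishes on that ideal and outside top degree, and
   int prod_{r in sigma} x_r = 1 / mult(sigma) for each maximal cone sigma. *)
Definition toric_integral (C Ray : finType) (u : Ray -> C -> int)
    (is_cone : {set Ray} -> bool) (f : {ffun Ray -> nat} -> rat) : Prop :=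
  [/\ forall m, ~~ is_cone (msupp_f m) -> f m = 0,
      forall m, mdeg_f m != #|C| -> f m = 0,
      forall (lam : C -> int) m,
        \sum_r (\sum_c lam c * u r c)%:~R * f (mmulX m r) = 0
    & forall I, is_cone I -> #|I| = #|C| -> f (mind I) = ((cone_mult u I)%:~R)^-1].

(* rays (i, j), 0 <= j <= k; coordinates of M (+) Z^{nk}: inl a (a < d) for
   M and inr (i, j') for e_{i, j'+1} *)
Definition ray_k (d n k : nat) (v : 'I_n -> 'rV[int]_d)
    (r : 'I_n * 'I_k.+1) (c : 'I_d + ('I_n * 'I_k)) : int :=
  match c with
  | inl a => v r.1 0 a
  | inr ij => if ij.1 == r.1 then
                (if nat_of_ord r.2 == 0%N then -1 else ((ij.2).+1 == r.2 :> nat)%:Z)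
              else 0
  end.

(* I spans a cone of Sigma_k iff the i with (i,0),...,(i,k) in I lie in a
   cone of Sigma, i.e. in some maximal simplex of T *)
Definition cone_k (n k : nat) (T : {set {set 'I_n}}) (I : {set 'I_n * 'I_k.+1}) : bool :=
  [exists S in T, [set i | [forall j : 'I_k.+1, (i, j) \in I]] \subset S].

(* int_{A_k} p = (k+1)^{-nk} int_{P_{Sigma_k}} p(D_i := (k+1) D_{i,0}) *)
Definition int_Ak (n k : nat) (f : {ffun 'I_n * 'I_k.+1 -> nat} -> rat)
    (p : {mpoly rat[n]}) : rat :=
  ((k.+1)%:R ^- (n * k)) *
  \sum_(m <- msupp p)
     p@_m * (k.+1)%:R ^+ mdeg m *
     f [ffun r : 'I_n * 'I_k.+1 => if nat_of_ord r.2 == 0%N then m r.1 else 0%N].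

(* int_A Phi_beta, beta = (b0, b), b0 <= 0, computed in A_k for
   k = max |b_i| >= max b_i *)
Definition int_Phi (n : nat) (f : forall k : nat, {ffun 'I_n * 'I_k.+1 -> nat} -> rat)
    (b0 : int) (b : 'I_n -> int) : rat :=
  let k := (\max_(i < n) absz (b i))%N in
  int_Ak (f k) ((- \sum_(i < n) 'X_i) ^+ absz b0 *
                \prod_(i < n) 'X_i ^+ absz (k%:Z - b i)).

(* bold vectors in Mbar = M (+) Z: index 0 is v_0 = 0 (+) 1, index i+1 is v_i (+) 1 *)
Definition bv (d n : nat) (v : 'I_n -> 'rV[int]_d) (i : 'I_n.+1) : 'rV[int]_(d + 1) :=
  row_mx (match unlift ord0 i with Some i' => v i' | None => 0 end) 1.

(* coefficient of a^e (e : 'I_n -> int) in the formal Laurent series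
   int_A Psi_P: the unique beta with b_i = e_i (i >= 1) and
   sum_i b_i bold(v_i) = -P has b0 = -(last coordinate of P) - sum_i e_i *)
Definition Psi_coef (d n : nat) (v : 'I_n -> 'rV[int]_d)
    (f : forall k : nat, {ffun 'I_n * 'I_k.+1 -> nat} -> rat)
    (P : 'rV[int]_(d + 1)) (e : 'I_n -> int) : rat :=
  let b0 := - P 0 (rshift d ord0) - \sum_(i < n) e i in
  let beta := fun i : 'I_n.+1 => match unlift ord0 i with Some i' => e i' | None => b0 end in
  if (\sum_(i < n.+1) beta i *: bv v i == - P) && (b0 <= 0) then int_Phi f b0 e else 0.

Definition Vol_J (d n : nat) (v : 'I_n -> 'rV[int]_d) (J : {set 'I_n.+1}) : int :=
  `|\det (\matrix_(a < d + 1, c < d + 1) (nth 0 [seq bv v i | i <- enum J] a) 0 c)|.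

Definition P_J (d n : nat) (v : 'I_n -> 'rV[int]_d) (J : {set 'I_n.+1}) : 'rV[int]_(d + 1) :=
  \sum_(i in J) bv v i - bv v ord0.

Definition has_card (d : nat) (P : 'rV[int]_d -> Prop) (c : nat) : Prop :=
  exists s : seq 'rV[int]_d, [/\ uniq s, size s = c & forall x, x \in s <-> P x].

(* V is the normalized volume d! vol(Delta) of Delta, vol being the Jordan
   content: d! #(N Delta cap M) / N^d --> V as N --> oo *)
Definition normalized_volume (d n : nat) (v : 'I_n -> 'rV[int]_d) (V : rat) : Prop :=
  forall eps : rat, 0 < eps -> exists N0 : nat, forall (N : nat) (c : nat),
    (N0 < N)%N ->
    has_card (fun x => in_Delta v ((N%:R)^-1 *: ratv x)) c ->
    `|(d`!)%:R * c%:R / (N%:R ^+ d) - V| < eps.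

(* Main.v *)
Require Import Defs.
From HB Require Import structures.
From mathcomp Require Import all_boot all_order all_algebra.
From mathcomp Require Import mpoly.
From mathcomp Require Import perm ring lra zify.
Import Order.TTheory GRing.Theory Num.Theory.
Set Implicit Arguments.
Unset Strict Implicit.
Unset Printing Implicit Defensive.
Local Open Scope ring_scope.

(* Put e_0 = 1 - sum e_i.  The coefficient of a^e in the sum is the integral of
   D_0^(-e_0) prod D_i^(-e_i) sum_J V(J)^2 D_J when sum e_i v_i = 0, and 0
   otherwise.  By Cauchy-Binet the sum over J is the Gram determinant
   det(sum_i D_i bv_i bv_i^T).  If e_0 <= 0 it vanishes because
   sum_i D_i bv_i = 0; if e_0 >= 2 no J contributes.  If e_0 = 1 only the J
   containing 0 contribute, which leaves the d-dimensional determinant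
   det(sum_i D_i v_i v_i^T).  When e <> 0, let x be the barycenter of the v_i
   with e_i < 0, with weights -e_i.  By convexity of Delta all monomials with
   nonzero integral live on facets containing x, so one of the two factors
   det(v_J) can be expanded as the sum of the determinants with one row replaced
   by x, and then sum_i D_i v_i = 0 applies again.  When e = 0 only the maximal
   cones J contribute, with total sum_(S in T) V(S); this is the volume of Delta,
   as one sees by counting lattice points in dilated simplices through the
   half-open parallelepipeds. *)

(** * Gram determinants *)

Definition rows_at (F : comPzRingType) (r m : nat) (w : 'I_m -> 'rV[F]_r)
    (I : 'I_r -> 'I_m) : 'M[F]_r :=
  \matrix_(a, c) w (I a) 0 c.

Definition set_row (F : comPzRingType) (r : nat) (A : 'M[F]_r) (k : 'I_r)
    (x : 'rV[F]_r) : 'M[F]_r :=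
  \matrix_(a, c) if a == k then x 0 c else A a c.

Definition upd (r m : nat) (I : {ffun 'I_r -> 'I_m}) (k : 'I_r) (i : 'I_m) :
    {ffun 'I_r -> 'I_m} :=
  [ffun a => if a == k then i else I a].

Lemma det_set_row (F : comPzRingType) (r : nat) (A : 'M[F]_r) k x :
  \det (set_row A k x) = \sum_c x 0 c * cofactor A k c.
Proof.
rewrite (expand_det_row _ k); apply: eq_bigr => c _.
rewrite mxE eqxx; congr (_ * _); rewrite /cofactor; congr (_ * \det _).
by apply/matrixP => a b; rewrite !mxE eq_sym (negbTE (neq_lift _ _)).
Qed.

(* With all rows and [x] on the affine hyperplane [l = 1], this is the
   contraction of the vanishing (r+1)-form [l /\ det] with [x]. *)
Lemma det_sum_set_row (F : comPzRingType) (r : nat) (A : 'M[F]_r) (x : 'rV[F]_r)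
    (l : 'cV[F]_r) :
  A *m l = const_mx 1 -> x *m l = const_mx 1 ->
  \det A = \sum_k \det (set_row A k x).
Proof.
move=> Al xl.
have -> : \sum_k \det (set_row A k x) = (x *m \adj A *m (A *m l)) 0 0.
  rewrite Al mxE; apply: eq_bigr => k _; rewrite det_set_row !mxE mulr1.
  by apply: eq_bigr => c _; rewrite !mxE.
by rewrite mulmxA -(mulmxA x) mul_adj_mx mul_mx_scalar -scalemxAl xl !mxE mulr1.
Qed.

(** Fubini over the value at [k]: maps that agree off [k] form one class, represented by its member
    with value [i0] at [k]. *)
Lemma sum_upd_eq0 (V : nmodType) (r m : nat) (G : {ffun 'I_r -> 'I_m} -> V) k :
  (forall I, \sum_i G (upd I k i) = 0) -> \sum_I G I = 0.
Proof.
move=> G0; case: (pickP 'I_m) => [i0 _ | no]; last first.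
  by rewrite big1 // => I _; have := no (I k).
rewrite (partition_big (fun I => upd I k i0) predT) //= big1 // => I0 _.
case: (eqVneq (I0 k) i0) => [I0k | I0k]; last first.
  rewrite big1 // => I /eqP /(congr1 (fun J : {ffun 'I_r -> 'I_m} => J k)).
  by rewrite ffunE eqxx => Ik; rewrite Ik eqxx in I0k.
rewrite -[RHS](G0 I0) (reindex_onto (upd I0 k) (fun I => I k)) /=; last first.
  move=> I /eqP <-; apply/ffunP => a; rewrite !ffunE.
  by case: eqVneq => [->|].
apply: eq_bigl => i; rewrite ffunE !eqxx andbT; apply/eqP/ffunP => a.
by rewrite !ffunE; case: eqVneq => [->|].
Qed.

(** Two injective enumerations of the same rows differ by a permutation; its sign disappears once
    minors are squared. *)
Lemma det_rows_at_inj (F : comPzRingType) (r m : nat) (w : 'I_m -> 'rV[F]_r)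
    (I I' : 'I_r -> 'I_m) :
  injective I -> injective I' -> (forall a, exists b, I a = I' b) ->
  exists s : 'S_r, \det (rows_at w I) = (-1) ^+ s * \det (rows_at w I').
Proof.
move=> Iinj I'inj sub.
have [h hE] := fin_all_exists sub.
have hinj : injective h by move=> a b hab; apply: Iinj; rewrite !hE hab.
exists (perm hinj); rewrite -det_perm -det_mulmx -row_permE.
by congr (\det _); apply/matrixP => a c; rewrite !mxE permE hE.
Qed.

Lemma det_rows_at_noninj (F : comPzRingType) (r m : nat) (w : 'I_m -> 'rV[F]_r)
    (I : {ffun 'I_r -> 'I_m}) :
  ~~ injectiveb I -> \det (rows_at w I) = 0.
Proof.
case/injectivePn => a [b ab Iab]; apply: (determinant_alternate ab) => c.
by rewrite !mxE Iab.
Qed.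

(** Each set of size [r] is the image of [r!] injective maps. Passing to maps lets a single index
    vary freely. *)
Lemma sum_sets_sum_ffuns (r m : nat) (G : {set 'I_m} -> rat)
    (H : {ffun 'I_r -> 'I_m} -> rat) :
  (forall I : {ffun 'I_r -> 'I_m}, ~~ injectiveb I -> H I = 0) ->
  (forall (I : {ffun 'I_r -> 'I_m}) (J : {set 'I_m}), injective I ->
     #|J| = r -> (forall a, I a \in J) -> H I = G J) ->
  \sum_I H I = (r`!)%:R * \sum_(J : {set 'I_m} | #|J| == r) G J.
Proof.
move=> H0 HG; rewrite (bigID (fun I : {ffun 'I_r -> 'I_m} => injectiveb I)) /= [X in _ + X]big1 ?addr0 //.
have imP (I : {ffun 'I_r -> 'I_m}) (J : {set 'I_m}) : injectiveb I -> #|J| = r ->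
    (I @: [set: 'I_r] == J) = (I \in ffun_on (mem J)).
  move=> /injectiveP Iinj cJ; apply/eqP/ffun_onP => [<- a|IJ].
    exact: imset_f.
  apply/eqP; rewrite eqEcard card_imset // cardsT card_ord cJ leqnn andbT.
  by apply/subsetP => _ /imsetP[a _ ->]; exact: IJ.
rewrite (partition_big (fun I : {ffun 'I_r -> 'I_m} => I @: [set: 'I_r])
   (fun J : {set 'I_m} => #|J| == r)) /=; last first.
  by move=> I /injectiveP Iinj; rewrite card_imset // cardsT card_ord.
rewrite mulr_sumr; apply: eq_bigr => J /eqP cJ.
transitivity (\sum_(I in [set f in ffun_on (mem J) | injectiveb (f : {ffun 'I_r -> 'I_m})]) G J).
  apply: eq_big => [I|I /andP[/injectiveP Iinj /eqP imI]].
    rewrite inE; case: (boolP (injectiveb I)) => Iinj; last by rewrite andbF.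
    by rewrite imP // andbT.
  by apply: HG => // a; rewrite -imI imset_f.
by rewrite sumr_const card_inj_ffuns_on cJ card_ord ffactnn mulr_natl.
Qed.

(** A squared minor is a product of two determinants. In one of them a row is replaced by [x], so
    its index survives only in the other determinant and in one factor [D i]; summing over that
    index gives 0 by the linear relation. *)
Lemma gram_sum_eq0 (r m : nat) (w : 'I_m -> 'rV[rat]_r) (P : comPzRingType)
    (D : 'I_m -> P) (L : P -> rat) (x : 'rV[rat]_r) (G : {set 'I_m} -> rat) :
  (forall p c, \sum_i w i 0 c * L (p * D i) = 0) ->
  (forall I : {ffun 'I_r -> 'I_m}, injective I -> \det (rows_at w I) != 0 ->
     L (\prod_a D (I a)) != 0 ->
     exists2 l : 'cV[rat]_r, forall a, w (I a) *m l = const_mx 1 & x *m l = const_mx 1) ->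
  (forall (I : {ffun 'I_r -> 'I_m}) (J : {set 'I_m}), injective I -> #|J| = r ->
     (forall a, I a \in J) -> G J = (\det (rows_at w I)) ^+ 2) ->
  \sum_(J : {set 'I_m} | #|J| == r) G J * L (\prod_(i in J) D i) = 0.
Proof.
move=> linL hyp GE.
pose H (I : {ffun 'I_r -> 'I_m}) := (\det (rows_at w I)) ^+ 2 * L (\prod_a D (I a)).
have sumH : \sum_I H I = (r`!)%:R * \sum_(J : {set 'I_m} | #|J| == r) G J * L (\prod_(i in J) D i).
  apply: sum_sets_sum_ffuns => [I /det_rows_at_noninj dI|I J Iinj cJ IJ].
    by rewrite /H dI expr0n mul0r.
  rewrite /H (GE I J) //; congr (_ * L _).
  have imI : I @: [set: 'I_r] = J.
    apply/eqP; rewrite eqEcard card_imset // cardsT card_ord cJ leqnn andbT.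
    by apply/subsetP => _ /imsetP[a _ ->]; exact: IJ.
  rewrite -imI big_imset /=; first by apply: eq_bigl => a; rewrite inE.
  by move=> a b _ _; exact: Iinj.
have r0 : (r`!)%:R != 0 :> rat by rewrite pnatr_eq0 -lt0n fact_gt0.
apply: (mulfI r0); rewrite -sumH mulr0.
(* The replacement needs the hyperplane [l = 1], which [hyp] provides where the minor and the value
   of [L] are nonzero; elsewhere both sides vanish. *)
transitivity (\sum_(I : {ffun 'I_r -> 'I_m}) \sum_k
  \det (rows_at w I) * \det (set_row (rows_at w I) k x) * L (\prod_a D (I a))).
  apply: eq_bigr => I _; rewrite -mulr_suml -mulr_sumr /H.
  have [->|dI] := eqVneq (\det (rows_at w I)) 0; first by rewrite expr0n !mul0r.
  have [->|LI] := eqVneq (L (\prod_a D (I a))) 0; first by rewrite !mulr0.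
  have Iinj : injective I.
    apply/injectiveP; apply: contraNT dI => nI; exact/eqP/det_rows_at_noninj.
  have [l wl xl] := hyp I Iinj dI LI.
  rewrite expr2 -(@det_sum_set_row _ _ _ x l) //.
  apply/matrixP => a b; have /matrixP/(_ 0 0) := wl a.
  by rewrite !mxE => <-; apply: eq_bigr => c _; rewrite !mxE (ord1 b).
rewrite exchange_big /= big1 // => k _.
apply: (@sum_upd_eq0 _ _ _ _ k) => I.
have updk i : upd I k i k = i by rewrite ffunE eqxx.
have updN i a : a != k -> upd I k i a = I a by move=> ak; rewrite ffunE (negbTE ak).
have rowE i : rows_at w (upd I k i) = set_row (rows_at w I) k (w i).
  by apply/matrixP => a c; rewrite !mxE ffunE; case: eqVneq.
have sr2 i : set_row (set_row (rows_at w I) k (w i)) k x = set_row (rows_at w I) k x.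
  by apply/matrixP => a c; rewrite !mxE; case: eqVneq.
have LE i : \prod_a D (upd I k i a) = \prod_(a | a != k) D (I a) * D i.
  by rewrite (bigD1 k) //= updk mulrC; congr (_ * _); apply: eq_bigr => a /updN ->.
(* With the remaining determinant expanded along row [k], the sum over the index becomes a
   combination of the relations [linL]. *)
under eq_bigr => i _ do rewrite rowE sr2 LE det_set_row 2!mulr_suml.
rewrite exchange_big /= big1 // => c _.
set K := \prod_(a | a != k) D (I a); set e := \det _; set q := cofactor _ _ _.
transitivity (e * q * \sum_i w i 0 c * L (K * D i)); last by rewrite linL mulr0.
by rewrite mulr_sumr; apply: eq_bigr => i _; ring.
Qed.

(** * Integrals over the higher Stanley-Reisner rings *)

(** The supports of [p], [q] and [p + q] differ; a common finite set containing them makes the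
    linearity of [int_Ak] termwise. *)
Lemma msupp_sum_sub (n : nat) (g : 'X_{1..n} -> rat) (p : {mpoly rat[n]})
    (s : seq 'X_{1..n}) :
  uniq s -> {subset msupp p <= s} ->
  \sum_(m <- msupp p) p@_m * g m = \sum_(m <- s) p@_m * g m.
Proof.
move=> us ps; rewrite [RHS](bigID (mem (msupp p))) /= [X in _ + X]big1 ?addr0.
  rewrite -[RHS]big_filter; apply: perm_big; apply: uniq_perm.
  - exact: msupp_uniq.
  - exact: filter_uniq.
  - by move=> m; rewrite mem_filter; case: (boolP (m \in _)) => //= /ps ->.
by move=> m mp; rewrite memN_msupp_eq0 ?mul0r.
Qed.

Lemma int_AkE (n k : nat) (f : {ffun 'I_n * 'I_k.+1 -> nat} -> rat) (p : {mpoly rat[n]}) :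
  int_Ak f p = \sum_(m <- msupp p) p@_m * int_Ak f 'X_[m].
Proof.
rewrite /int_Ak mulr_sumr; apply: eq_bigr => m _.
by rewrite msuppX big_seq1 mcoeffX eqxx mul1r -!mulrA mulrCA.
Qed.

Lemma int_Ak_sub (n k : nat) (f : {ffun 'I_n * 'I_k.+1 -> nat} -> rat) (p : {mpoly rat[n]})
    (s : seq 'X_{1..n}) :
  uniq s -> {subset msupp p <= s} ->
  int_Ak f p = \sum_(m <- s) p@_m * int_Ak f 'X_[m].
Proof. by move=> us ps; rewrite int_AkE (msupp_sum_sub _ us ps). Qed.

Lemma int_AkD (n k : nat) (f : {ffun 'I_n * 'I_k.+1 -> nat} -> rat) (p q : {mpoly rat[n]}) :
  int_Ak f (p + q) = int_Ak f p + int_Ak f q.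
Proof.
pose s := undup (msupp p ++ msupp q ++ msupp (p + q)).
have us : uniq s by exact: undup_uniq.
have [sp sq spq] : [/\ {subset msupp p <= s}, {subset msupp q <= s}
    & {subset msupp (p + q) <= s}].
  by split=> m; rewrite mem_undup !mem_cat => ->; rewrite ?orbT.
rewrite (int_Ak_sub _ us sp) (int_Ak_sub _ us sq) (int_Ak_sub _ us spq) -big_split.
by apply: eq_bigr => m _; rewrite mcoeffD mulrDl.
Qed.

Lemma int_AkZ (n k : nat) (f : {ffun 'I_n * 'I_k.+1 -> nat} -> rat) c (p : {mpoly rat[n]}) :
  int_Ak f (c *: p) = c * int_Ak f p.
Proof.
pose s := undup (msupp p ++ msupp (c *: p)).
have us : uniq s by exact: undup_uniq.
have [sp scp] : {subset msupp p <= s} /\ {subset msupp (c *: p) <= s}.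
  by split=> m; rewrite mem_undup !mem_cat => ->; rewrite ?orbT.
rewrite (int_Ak_sub _ us sp) (int_Ak_sub _ us scp) mulr_sumr.
by apply: eq_bigr => m _; rewrite mcoeffZ -mulrA.
Qed.

Lemma int_Ak0 (n k : nat) (f : {ffun 'I_n * 'I_k.+1 -> nat} -> rat) : int_Ak f 0 = 0.
Proof. by rewrite -(scale0r 0) int_AkZ mul0r. Qed.

Lemma int_Ak_sum (n k : nat) (f : {ffun 'I_n * 'I_k.+1 -> nat} -> rat)
    (I : Type) (s : seq I) (F : I -> {mpoly rat[n]}) :
  int_Ak f (\sum_(i <- s) F i) = \sum_(i <- s) int_Ak f (F i).
Proof.
elim: s => [|i s IHs]; first by rewrite !big_nil int_Ak0.
by rewrite !big_cons int_AkD IHs.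
Qed.

(** * Monomials in the [D i] and cones of [Sigma_k] *)

Definition col0 (n k : nat) (m : 'I_n -> nat) : {ffun 'I_n * 'I_k.+1 -> nat} :=
  [ffun r : 'I_n * 'I_k.+1 => if nat_of_ord r.2 == 0%N then m r.1 else 0%N].

(** The monomial with row sums [m] whose row [i] is full exactly when [m i > k]: one unit for each
    [j >= 1] while they last, the excess over [k] at [j = 0]. *)
Definition spread (n k : nat) (m : 'I_n -> nat) : {ffun 'I_n * 'I_k.+1 -> nat} :=
  [ffun r : 'I_n * 'I_k.+1 =>
     if nat_of_ord r.2 == 0%N then (m r.1 - k)%N else nat_of_bool (r.2 <= m r.1)%N].

Definition rowsum (n k : nat) (m : {ffun 'I_n * 'I_k.+1 -> nat}) (i : 'I_n) : nat :=
  (\sum_(j < k.+1) m (i, j))%N.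

Lemma rowsum_col0 (n k : nat) (m : 'I_n -> nat) i : rowsum (col0 k m) i = m i.
Proof.
rewrite /rowsum big_ord_recl ffunE /= big1 ?addn0 // => j _.
by rewrite ffunE.
Qed.

Lemma sum_ord_lt (k m : nat) : (\sum_(j < k) (j < m) = minn k m)%N.
Proof. by elim: k => [|k IHk]; rewrite ?big_ord0 ?big_ord_recr /= ?IHk; lia. Qed.

Lemma rowsum_spread (n k : nat) (m : 'I_n -> nat) i : rowsum (spread k m) i = m i.
Proof.
rewrite /rowsum big_ord_recl ffunE /=.
under eq_bigr => j _ do rewrite ffunE /= /bump /= add1n.
by rewrite sum_ord_lt; lia.
Qed.

(** Reordering rays and coordinates permutes rows and columns, which changes the determinant only by
    a sign. *)
Lemma cone_mult_enum (C Ray : finType) (u : Ray -> C -> int) (I : {set Ray}) (N : nat)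
    (rw : 'I_N -> Ray) (cl : 'I_N -> C) :
  N = #|C| -> #|I| = #|C| -> injective rw -> (forall a, rw a \in I) -> injective cl ->
  cone_mult u I = `|\det (\matrix_(a, b) u (rw a) (cl b))|.
Proof.
move=> NC cI rwinj rwI clinj; subst N.
have idx a : exists b : 'I_#|C|, nth (rw a) (enum I) b = rw a.
  have lt : (index (rw a) (enum I) < #|C|)%N by rewrite -cI cardE index_mem mem_enum.
  by exists (Ordinal lt); rewrite nth_index // mem_enum.
have [s sE] := fin_all_exists idx.
have sinj : injective s.
  move=> a b sab; apply: rwinj; rewrite -(sE a) -(sE b) sab.
  by apply: set_nth_default; rewrite -cardE cI.
have tinj : injective (fun b => enum_rank (cl b)) by move=> a b /enum_rank_inj /clinj.
pose A := \matrix_(a < #|C|, b < #|C|) (nth (fun _ => 0) [seq u r | r <- enum I] a) (enum_val b).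
have -> : \matrix_(a, b) u (rw a) (cl b) = row_perm (perm sinj) (col_perm (perm tinj) A).
  apply/matrixP => a b; rewrite !mxE !permE enum_rankK.
  by rewrite (nth_map (rw a)) ?sE // -cardE cI.
rewrite row_permE col_permE !det_mulmx !det_perm !normrM !normrX !normrN1 !expr1n.
by rewrite mul1r mulr1.
Qed.

Lemma rows_mx_enum (d n : nat) (v : 'I_n -> 'rV[int]_d) (S : {set 'I_n}) :
  #|S| = d ->
  exists g : 'I_d -> 'I_n,
    [/\ injective g, forall a, g a \in S, forall i, i \in S -> exists a, g a = i
      & rows_mx v S = rows_at v g].
Proof.
move=> cS; pose g (a : 'I_d) := enum_val (cast_ord (esym cS) a).
exists g; split=> [a b /enum_val_inj/cast_ord_inj //|a|i iS|].
- exact: enum_valP.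
- exists (cast_ord cS (enum_rank_in iS i)).
  by rewrite /g cast_ordK enum_rankK_in.
apply/matrixP => a c; rewrite !mxE /g (enum_val_nth (g a)) (nth_map (g a)) //.
by rewrite -cardE cS.
Qed.

Lemma sum_pair (V : nmodType) (I J : finType) (F : I * J -> V) :
  \sum_r F r = \sum_i \sum_j F (i, j).
Proof. by rewrite pair_bigA; apply: eq_bigr => -[]. Qed.

(** The image in [A_k] of the product of the [D i], [i] in [S], taken in [A_0]. *)
Definition topmon (n k : nat) (S : {set 'I_n}) : 'X_{1..n} :=
  [multinom (k + (i \in S))%N | i < n].

Lemma mdeg_topmon (n k : nat) (S : {set 'I_n}) : mdeg (topmon k S) = (n * k + #|S|)%N.
Proof.
rewrite mdegE; under eq_bigr => i _ do rewrite mnmE.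
by rewrite big_split /= sum_nat_const card_ord -sum1_card [in RHS]big_mkcond.
Qed.

(** Among the maximal cones of [Sigma_k] over a maximal cone [S], the one that omits the ray
    [(i, 0)] in every row [i] outside [S]. *)
Definition cone_rays (n k : nat) (S : {set 'I_n}) : {set 'I_n * 'I_k.+1} :=
  [set r | (nat_of_ord r.2 != 0%N) || (r.1 \in S)].

Lemma spread_topmon (n k : nat) (S : {set 'I_n}) :
  spread k (topmon k S) = mind (cone_rays k S).
Proof.
apply/ffunP => -[i j]; rewrite !ffunE inE mnmE /=; case: eqP => _ /=.
  by rewrite addKn.
by rewrite (leq_trans (leq_ord j)) // leq_addr.
Qed.

Lemma card_cone_rays (n k : nat) (S : {set 'I_n}) : #|cone_rays k S| = (n * k + #|S|)%N.
Proof.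
rewrite -mdeg_topmon mdegE -sum1_card [LHS]big_mkcond /= sum_pair; apply: eq_bigr => i _.
rewrite -[RHS](rowsum_spread k (topmon k S)) spread_topmon; apply: eq_bigr => j _.
by rewrite ffunE; case: (_ \in _).
Qed.

(* The minor of [Sigma_k] reduces by the Schur complement of its identity block:
   the [d] rows of the rays [(i, 0)] become [(k + 1) v_i]. *)
Lemma cone_mult_cone_rays (d n k : nat) (v : 'I_n -> 'rV[int]_d) (S : {set 'I_n}) :
  #|S| = d ->
  cone_mult (ray_k v (k := k)) (cone_rays k S) =
  (k.+1)%:Z ^+ d * `|\det (rows_mx v S)|.
Proof.
move=> cS; have [g [ginj gS _ ->]] := rows_mx_enum v cS.
pose q := #|{: 'I_n * 'I_k}|.
pose rw (a : 'I_(d + q)) : 'I_n * 'I_k.+1 := match split a with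
  | inl a => (g a, ord0) | inr p => ((enum_val p).1, lift ord0 (enum_val p).2) end.
pose cl (b : 'I_(d + q)) : 'I_d + 'I_n * 'I_k := match split b with
  | inl a => inl a | inr p => inr (enum_val p) end.
have rwl a : rw (lshift q a) = (g a, ord0) by rewrite /rw (unsplitK (inl a)).
have rwr p : rw (rshift d p) = ((enum_val p).1, lift ord0 (enum_val p).2).
  by rewrite /rw (unsplitK (inr p)).
have cll a : cl (lshift q a) = inl a by rewrite /cl (unsplitK (inl a)).
have clr p : cl (rshift d p) = inr (enum_val p) by rewrite /cl (unsplitK (inr p)).
have cC : #|{: 'I_d + 'I_n * 'I_k}| = (n * k + d)%N.
  by rewrite card_sum card_prod !card_ord addnC.
rewrite (@cone_mult_enum _ _ _ _ (d + q) rw cl).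
- pose V := rows_at v g.
  pose B : 'M[int]_(d, q) := \matrix_(a, p) (g a == (enum_val p).1)%:Z.
  pose W : 'M[int]_(q, d) := \matrix_(p, c) v (enum_val p).1 0 c.
  have -> : \matrix_(a, b) ray_k v (rw a) (cl b) = block_mx V (- B) W 1%:M.
    apply/matrixP => a b; rewrite mxE.
    case: (split_ordP a) => a' ->; case: (split_ordP b) => b' ->.
    + by rewrite block_mxEul rwl cll !mxE.
    + by rewrite block_mxEur rwl clr !mxE /= eq_sym; case: eqP.
    + by rewrite block_mxEdl rwr cll !mxE.
    + rewrite block_mxEdr rwr clr !mxE /= -(inj_eq enum_val_inj).
      case: (enum_val a') (enum_val b') => [i j] [i' j'] /=.
      rewrite xpair_eqE (eq_sym i) -[bump 0 j]/(j.+1) eqSS.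
      have -> : (j == j') = (nat_of_ord j' == j) by rewrite eq_sym.
      by case: (i' == i); case: (nat_of_ord j' == j).
  have -> : \det (block_mx V (- B) W 1%:M) =
      \det (block_mx 1%:M B 0 1%:M *m block_mx V (- B) W 1%:M).
    by rewrite det_mulmx det_ublock !det1 !mul1r.
  rewrite mulmx_block !mul1mx !mul0mx !mulmx1 addNr !add0r det_lblock det1 mulr1.
  have -> : V + B *m W = (k.+1)%:Z *: V.
    apply/matrixP => a c; rewrite !mxE.
    under eq_bigr => p _ do rewrite !mxE.
    rewrite -(big_enum_val (fun e : 'I_n * 'I_k => (g a == e.1)%:Z * v e.1 0 c)) /=.
    rewrite sum_pair (bigD1 (g a)) //= [X in _ + (_ + X)]big1 => [|i ga]; last first.
      by rewrite big1 // => j _; rewrite eq_sym (negbTE ga) mul0r.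
    by rewrite eqxx mul1r sumr_const card_ord addr0 intS mulrDl mul1r -mulr_natl natz.
  by rewrite detZ normrM normrX.
- by rewrite cC /q card_prod !card_ord addnC.
- by rewrite cC card_cone_rays cS.
- move=> a b; case: (split_ordP a) => a' ->; case: (split_ordP b) => b' ->.
  + by rewrite !rwl => -[/ginj ->].
  + by rewrite rwl rwr => -[].
  + by rewrite rwl rwr => -[].
  + rewrite !rwr => /eqP; rewrite xpair_eqE => /andP[/eqP e1 /eqP/lift_inj e2]; congr (rshift _ _); apply: enum_val_inj.
    by rewrite (surjective_pairing (enum_val a')) e1 e2 -surjective_pairing.
- move=> a; case: (split_ordP a) => a' ->; rewrite inE.
  + by rewrite rwl gS orbT.
  + by rewrite rwr.
- move=> a b; case: (split_ordP a) => a' ->; case: (split_ordP b) => b' ->.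
  + by rewrite !cll => -[->].
  + by rewrite cll clr.
  + by rewrite cll clr.
  + by rewrite !clr => -[/enum_val_inj ->].
Qed.

Section ToricIntegral.

Variables (d n k : nat) (v : 'I_n -> 'rV[int]_d) (T : {set {set 'I_n}}).
Variable f : {ffun 'I_n * 'I_k.+1 -> nat} -> rat.
Hypothesis tf : toric_integral (ray_k v (k := k)) (@cone_k n k T) f.

Local Notation C := ('I_d + 'I_n * 'I_k)%type.

Lemma card_coords : #|{: C}| = (n * k + d)%N.
Proof. by rewrite card_sum card_prod !card_ord addnC. Qed.

Lemma sum_coord (c0 : C) (r : 'I_n * 'I_k.+1) :
  \sum_c (c == c0)%:Z * ray_k v r c = ray_k v r c0.
Proof.
rewrite (bigD1 c0) //= eqxx mul1r big1 ?addr0 // => c cc0.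
by rewrite (negbTE cc0) mul0r.
Qed.

Lemma toric_lin (c : C) m : \sum_r (ray_k v r c)%:~R * f (mmulX m r) = 0.
Proof.
case: tf => _ _ /(_ (fun c' => (c' == c)%:Z) m) lin0 _; apply: etrans lin0.
by apply: eq_bigr => r _; rewrite sum_coord.
Qed.

(** The coordinate [e_{i,j}] is 1 on the ray [(i, j)], -1 on [(i, 0)] and 0 on all other rays, so
    its linear relation identifies the two divisors. *)
Lemma toric_exchange m i j : f (mmulX m (i, j)) = f (mmulX m (i, ord0)).
Proof.
case: (unliftP ord0 j) => [j'|] -> //.
have := toric_lin (inr (i, j')) m; rewrite /ray_k /=.
have ne0 : (i, ord0) != (i, lift ord0 j') by rewrite xpair_eqE negb_and neq_lift orbT.
rewrite (bigD1 (i, lift ord0 j')) //= (bigD1 (i, ord0)) //= eqxx /=.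
rewrite big1 => [|[i1 j1] /=].
  rewrite /bump /= add1n eqxx mulrNz mulr1z mul1r mulN1r addr0 => /eqP.
  by rewrite subr_eq0 => /eqP.
rewrite !xpair_eqE; case: eqVneq => [->|]; last by rewrite mul0r.
rewrite /= => /andP[]; case: (unliftP ord0 j1) => [j2|] -> j12; last by rewrite eqxx.
move=> _.
rewrite !lift0 /= eqSS; case: eqVneq => [jj|]; last by rewrite mul0r.
by case/negP: j12; rewrite -(val_inj jj).
Qed.

Lemma rowsum_mmulX (m : {ffun 'I_n * 'I_k.+1 -> nat}) r i :
  rowsum (mmulX m r) i = (rowsum m i + (i == r.1))%N.
Proof.
rewrite /rowsum; under eq_bigr => j _ do rewrite ffunE.
rewrite big_split /=; congr addn; case: r => i1 j1 /=.
rewrite (bigD1 j1) //= big1 => [|j jj1]; first by rewrite xpair_eqE eqxx andbT addn0.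
by rewrite xpair_eqE (negbTE jj1) andbF.
Qed.

(** Units are moved one at a time to [j = 0] by [toric_exchange]; the induction is on the total
    exponent off [j = 0]. *)
Lemma toric_rowsum m : f m = f (col0 k (rowsum m)).
Proof.
have [N leN] : exists N, (\sum_(r | nat_of_ord r.2 != 0) m r <= N)%N.
  by exists (\sum_(r | nat_of_ord r.2 != 0) m r)%N.
elim: N => [|N IHN] in m leN *.
  congr f; apply/ffunP => -[i j]; rewrite ffunE /=.
  have m0 (j' : 'I_k.+1) : nat_of_ord j' != 0%N -> m (i, j') = 0%N.
    move=> j'0; move: leN; rewrite leqn0 sum_nat_eq0 => /forallP/(_ (i, j')) /=.
    by rewrite j'0 => /eqP.
  case: eqVneq => [j0|/m0 //]; rewrite /rowsum (bigD1 j) //= big1 ?addn0 // => j' j'j.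
  by apply: m0; apply: contra j'j => /eqP j'0; apply/eqP/val_inj; rewrite /= j0 j'0.
have [/existsP[r /andP[r0 mr]] | no] := boolP [exists r : 'I_n * 'I_k.+1,
  (nat_of_ord r.2 != 0) && (m r != 0)%N]; last first.
  apply: IHN; rewrite big1 // => r r0; apply/eqP; apply: contraNT no => mr.
  by apply/existsP; exists r; rewrite r0.
have [m' mE] : exists m', m = mmulX m' r.
  exists [ffun r' => (m r' - (r' == r))%N].
  apply/ffunP => r'; rewrite !ffunE; case: eqVneq => [->|_]; last by rewrite subn0 addn0.
  by rewrite subnK // lt0n.
have r0' : (r == (r.1, ord0)) = false by apply: contraNF r0 => /eqP ->.
have -> : f m = f (mmulX m' (r.1, ord0)) by rewrite mE {1}(surjective_pairing r) toric_exchange.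
rewrite IHN.
  by congr f; apply/ffunP => r'; rewrite !ffunE /= mE !rowsum_mmulX.
move: leN; rewrite mE (bigD1 r) //= [X in _ -> (X <= _)%N](bigD1 r) //= !ffunE eqxx r0'.
rewrite addn1 addn0 addSn ltnS => leN; apply: leq_trans leN.
rewrite leq_add2l; apply: eq_leq.
apply: eq_bigr => r' /andP[r'0 r'r]; rewrite !ffunE (negbTE r'r).
suff -> : (r' == (r.1, ord0)) = false by [].
by apply: contraNF r'0 => /eqP ->.
Qed.

Lemma int_AkX (m : 'X_{1..n}) :
  int_Ak f 'X_[m] = (k.+1)%:R ^- (n * k) * ((k.+1)%:R ^+ mdeg m * f (col0 k m)).
Proof. by rewrite /int_Ak msuppX big_seq1 mcoeffX eqxx mul1r. Qed.

Lemma toric_spread (m : 'X_{1..n}) : f (col0 k m) = f (spread k m).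
Proof.
rewrite [RHS]toric_rowsum; congr f; apply/ffunP => r.
by rewrite !ffunE rowsum_spread.
Qed.

Lemma full_spread (m : 'X_{1..n}) :
  [set i | [forall j : 'I_k.+1, (i, j) \in msupp_f (spread k m)]] = [set i | (k < m i)%N].
Proof.
apply/setP => i; rewrite !inE; apply/forallP/idP => [/(_ ord0)|ki j].
  by rewrite inE ffunE /= subn_eq0 -ltnNge.
rewrite inE ffunE; case: ifP => /= _; first by rewrite subn_eq0 -ltnNge.
by rewrite (leq_trans (ltnW (ltn_ord j)) ki).
Qed.

(** Spreading the exponents turns the monomial relation of [A_k] into the Stanley-Reisner relation
    of [Sigma_k]. *)
Lemma int_Ak_noncone (m : 'X_{1..n}) :
  ~~ [exists S in T, [set i | (k < m i)%N] \subset S] -> int_Ak f 'X_[m] = 0.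
Proof.
move=> ncone; rewrite int_AkX toric_spread; case: tf => -> //; first by rewrite !mulr0.
by rewrite /cone_k full_spread.
Qed.

Lemma int_Ak_deg (m : 'X_{1..n}) : mdeg m != (n * k + d)%N -> int_Ak f 'X_[m] = 0.
Proof.
move=> degm; rewrite int_AkX; case: tf => _ -> //; first by rewrite !mulr0.
rewrite card_coords; apply: contra degm => /eqP <-; rewrite mdegE /mdeg_f.
rewrite [eqbRHS]sum_pair; apply/eqP/eq_bigr => i _.
by rewrite -[RHS]/(rowsum _ _) rowsum_col0.
Qed.

Lemma int_Ak_linX (m : 'X_{1..n}) a :
  \sum_i (v i 0 a)%:~R * int_Ak f ('X_[m] * 'X_i) = 0.
Proof.
have k0 : (k.+1)%:R != 0 :> rat by rewrite pnatr_eq0.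
(* The relation on [Sigma_k] counts each [v i] once for every one of the [k + 1] rays of its row,
   and these give equal terms. *)
apply: (mulfI k0); rewrite mulr0 mulr_sumr.
pose c : rat := (k.+1)%:R ^- (n * k) * (k.+1)%:R ^+ (mdeg m).+1.
transitivity (c * \sum_r (ray_k v r (inl a))%:~R * f (mmulX (col0 k m) r)); last first.
  by rewrite toric_lin mulr0.
rewrite mulr_sumr sum_pair.
apply: eq_bigr => i _; rewrite -mpolyXD int_AkX mdegD mdeg1 addn1.
have -> : col0 k (m + U_(i))%MM = mmulX (col0 k m) (i, ord0).
  apply/ffunP => -[i' j]; rewrite !ffunE /= mnmDE mnm1E xpair_eqE (eq_sym i').
  have -> : (j == ord0) = (nat_of_ord j == 0%N) by [].
  by case: (nat_of_ord j == 0%N); rewrite ?andbT // andbF.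
under eq_bigr => j _ do rewrite toric_exchange /=.
rewrite sumr_const card_ord -[RHS]mulr_natl /c; congr (_ * _).
by rewrite [RHS]mulrCA !mulrA.
Qed.

Lemma int_Ak_lin (p : {mpoly rat[n]}) a :
  \sum_i (v i 0 a)%:~R * int_Ak f (p * 'X_i) = 0.
Proof.
elim/mpolyind: p => [|c m p _ _ IHp].
  by rewrite big1 // => i _; rewrite mul0r int_Ak0 mulr0.
under eq_bigr => i _ do rewrite mulrDl int_AkD -scalerAl int_AkZ mulrDr mulrCA.
by rewrite big_split /= IHp addr0 -mulr_sumr int_Ak_linX mulr0.
Qed.

(** The powers of [k + 1] cancel: [-nk] from the normalization, [nk + d] from the substitution, [-d]
    from the multiplicity of the cone. *)
Lemma int_Ak_cone (S : {set 'I_n}) : S \in T -> #|S| = d ->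
  int_Ak f 'X_[topmon k S] = ((`|\det (rows_mx v S)|)%:~R)^-1.
Proof.
move=> ST cS; have k0 : (k.+1)%:R != 0 :> rat by rewrite pnatr_eq0.
rewrite int_AkX toric_spread spread_topmon mdeg_topmon cS.
case: tf => _ _ _ -> //; first last.
- by rewrite card_cone_rays cS card_coords.
- apply/existsP; exists S; rewrite ST /=; apply/subsetP => i; rewrite inE.
  by move=> /forallP/(_ ord0); rewrite inE.
rewrite cone_mult_cone_rays // intrM rmorphXn /= invfM exprD -!mulrA.
by rewrite -pmulrn mulKf ?expf_neq0 // mulVKf ?expf_neq0.
Qed.

End ToricIntegral.

(** * Stability in k *)

Lemma exists_functional (d n : nat) (v : 'I_n -> 'rV[int]_d) (S : {set 'I_n}) (y : 'I_n -> rat) :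
  #|S| = d -> \det (rows_mx v S) != 0 ->
  exists l : 'cV[rat]_d, forall i, i \in S -> (ratv (v i) *m l) 0 0 = y i.
Proof.
move=> cS; have [g [_ gS Sg ->]] := rows_mx_enum v cS => dV.
pose A : 'M[rat]_d := map_mx intr (rows_at v g).
have uA : A \in unitmx by rewrite unitmxE det_map_mx unitfE intr_eq0.
exists (invmx A *m \col_a y (g a)) => i /Sg[a <-].
transitivity ((A *m (invmx A *m \col_a y (g a))) a 0); last by rewrite mulKVmx // mxE.
by rewrite !mxE; apply: eq_bigr => c _; rewrite !mxE.
Qed.

(* The linear relation dual to a ray [i0] of [S] with exponent at least [k + 2]
   trades one [i0] for rays outside [S], which lowers the total excess of [m]
   over [k + 1]; monomials without such excess are top monomials of cones. *)
Lemma top_functional_eq0 (d n k : nat) (v : 'I_n -> 'rV[int]_d) (T : {set {set 'I_n}})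
    (h : 'X_{1..n} -> rat) :
  (forall S, S \in T -> #|S| = d /\ \det (rows_mx v S) != 0) ->
  (forall m a, \sum_i (v i 0 a)%:~R * h (m + U_(i))%MM = 0) ->
  (forall m : 'X_{1..n}, ~~ [exists S in T, [set i | (k < m i)%N] \subset S] -> h m = 0) ->
  (forall S, S \in T -> h (topmon k S) = 0) ->
  forall m, mdeg m = (n * k + d)%N -> h m = 0.
Proof.
move=> TS hlin hcone htop m.
have [N] := ubnP (\sum_i (m i - k.+1))%N.
elim: N => // N IHN in m *; rewrite ltnS => mN degm.
have [/existsP[S /andP[ST /subsetP mS]] | /hcone //] :=
  boolP [exists S in T, [set i | (k < m i)%N] \subset S].
have {}mS i : i \notin S -> (m i <= k)%N.
  by move=> iS; rewrite leqNgt; apply: contra iS => ki; apply: mS; rewrite inE.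
have [cS dS] := TS S ST.
have [/existsP[i0 mi0] | /existsPn mle] := boolP [exists i0, (k.+1 < m i0)%N]; last first.
  (* Without excess [m] is pointwise below [topmon k S], and equality of degrees forces equality. *)
  suff -> : m = topmon k S by exact: htop.
  have mleS i : (m i <= topmon k S i)%N.
    rewrite mnmE; case: (boolP (i \in S)) => iS; last by rewrite addn0 mS.
    by rewrite addn1 leqNgt mle.
  have /leqif_sum : forall i, true -> (m i <= topmon k S i ?= iff (m i == topmon k S i))%N.
    by move=> i _; apply/leqifP; case: eqVneq => // ne; rewrite ltn_neqAle ne mleS.
  move=> [_]; rewrite -!mdegE degm mdeg_topmon cS eqxx => /esym/forallP eqm.
  by apply/mnmP => i; apply/eqP/eqm.
have i0S : i0 \in S by apply/negPn/negP => /mS; lia.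
pose m' := (m - U_(i0))%MM.
have mE : m = (m' + U_(i0))%MM.
  by rewrite submK //; apply/mnm_lepP => i; rewrite mnm1E; case: eqP => [<-|] //; lia.
have [l lS] := exists_functional (fun i => (i == i0)%:R) cS dS.
have sum0 : \sum_i (ratv (v i) *m l) 0 0 * h (m' + U_(i))%MM = 0.
  under eq_bigr => i _ do rewrite mxE mulr_suml.
  rewrite exchange_big big1 //= => a _.
  under eq_bigr => i _ do rewrite mxE -mulrA mulrCA.
  by rewrite -mulr_sumr hlin mulr0.
move: sum0; rewrite (bigD1 i0) //= lS // eqxx mul1r -mE big1 ?addr0 // => i ii0.
have [iS | iS] := boolP (i \in S); first by rewrite lS // (negbTE ii0) mul0r.
have m'E j : (m' + U_(i))%MM j = ((m j - (j == i0)) + (i == j))%N.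
  by rewrite mnmDE mnm1E mnmBE mnm1E (eq_sym i0).
rewrite IHN ?mulr0 //; last first.
  by move: degm; rewrite {1}mE !mdegD !mdeg1.
apply: leq_trans mN; rewrite (bigD1 i0) //= [X in (_ < X)%N](bigD1 i0) //=.
rewrite -addSn leq_add //.
  by rewrite m'E eqxx (negbTE ii0) addn0; lia.
apply: leq_sum => j ji0; rewrite m'E (negbTE ji0) subn0.
(* The ray [i] outside [S] has [m i <= k], so one more unit creates no excess over [k + 1]. *)
case: eqVneq => [<-|] /=; last by rewrite addn0.
by have := mS i iS; lia.
Qed.

Definition ones (n : nat) : 'X_{1..n} := [multinom 1%N | i < n].

Section Stability.

Variables (d n : nat) (v : 'I_n -> 'rV[int]_d) (T : {set {set 'I_n}}).
Variable f : forall k : nat, {ffun 'I_n * 'I_k.+1 -> nat} -> rat.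
Hypothesis TS : forall S, S \in T -> #|S| = d /\ \det (rows_mx v S) != 0.
Hypothesis tf : forall k : nat, toric_integral (ray_k v (k := k)) (@cone_k n k T) (@f k).

(** Both sides satisfy the linear and monomial relations of [A_k] and agree on the top monomials of
    cones, so [top_functional_eq0] applies to their difference. *)
Lemma int_Ak_stab1 k (p : {mpoly rat[n]}) :
  int_Ak (@f k) p = int_Ak (@f k.+1) (p * 'X_[ones n]).
Proof.
elim/mpolyind: p => [|c m p _ _ IHp]; first by rewrite mul0r !int_Ak0.
rewrite mulrDl !int_AkD -IHp -scalerAl !int_AkZ -mpolyXD; congr (c * _ + _).
have degO : mdeg (ones n) = n.
  by rewrite mdegE; under eq_bigr do rewrite mnmE; rewrite sum1_card card_ord.
(* Multiplication by [ones n] shifts the degree by [n], as the top degree does; off top degree both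
   integrals vanish. *)
have [degm | degm] := eqVneq (mdeg m) (n * k + d)%N; last first.
  rewrite (int_Ak_deg (@tf k)) // (int_Ak_deg (@tf k.+1)) // mdegD degO mulnS.
  by apply: contra degm; lia.
pose h m' := int_Ak (@f k) 'X_[m'] - int_Ak (@f k.+1) 'X_[m' + ones n].
apply/eqP; rewrite -subr_eq0; apply/eqP; rewrite -/(h m).
apply: (top_functional_eq0 TS _ _ _ degm) => [m' a|m' nc|S ST].
- transitivity (\sum_i (v i 0 a)%:~R * int_Ak (@f k) ('X_[m'] * 'X_i) -
      \sum_i (v i 0 a)%:~R * int_Ak (@f k.+1) ('X_[m' + ones n] * 'X_i)).
    rewrite -sumrB; apply: eq_bigr => i _; rewrite -!mpolyXD -mulrBr /h.
    have -> // : (m' + U_(i) + ones n)%MM = (m' + ones n + U_(i))%MM.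
    by apply/mnmP => j; rewrite !mnmDE addnAC.
  by rewrite !(int_Ak_lin (@tf _)) subrr.
- rewrite /h (int_Ak_noncone (@tf k)) // (int_Ak_noncone (@tf k.+1)) ?subrr //.
  apply: contra nc => /existsP[S /andP[ST sub]]; apply/existsP; exists S; rewrite ST.
  apply: subset_trans sub; apply/subsetP => i; rewrite !inE mnmDE mnmE; lia.
- have [cS dS] := TS ST.
  rewrite /h.
  have -> : (topmon k S + ones n)%MM = topmon k.+1 S.
    by apply/mnmP => i; rewrite mnmDE !mnmE; lia.
  by rewrite (int_Ak_cone (@tf k)) // (int_Ak_cone (@tf k.+1)) // subrr.
Qed.

Lemma int_Ak_stab k l (p : {mpoly rat[n]}) :
  int_Ak (@f k) p = int_Ak (@f (l + k)) (p * 'X_[ones n *+ l]).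
Proof.
elim: l => [|l IHl] in p *; first by rewrite mulm0n mpolyX0 mulr1.
by rewrite mulmSr mpolyXD mulrA addSn -int_Ak_stab1 -IHl.
Qed.

(** This allows all the [Phi] of one coefficient to be computed in a single ring [A_K]. *)
Lemma int_PhiE K b0 (b : 'I_n -> int) :
  (forall i, absz (b i) <= K)%N ->
  int_Phi (fun k => @f k) b0 b =
  int_Ak (@f K) ((- \sum_(i < n) 'X_i) ^+ absz b0 * \prod_(i < n) 'X_i ^+ absz (K%:Z - b i)).
Proof.
move=> bK; rewrite /int_Phi; set k := (\max_(i < n) _)%N.
have bk i : (absz (b i) <= k)%N by exact: (leq_bigmax i).
have kK : (k <= K)%N by apply/bigmax_leqP => i _.
rewrite (int_Ak_stab _ (K - k)) subnK // -mulrA; congr (int_Ak _ (_ * _)).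
rewrite mpolyXE_id -big_split /=; apply: eq_bigr => i _.
rewrite mulmnE mnmE mul1n -exprD; congr (_ ^+ _).
by have := bk i; lia.
Qed.

End Stability.

(** * Convexity *)

Lemma cone_coordinates (d n : nat) (v : 'I_n -> 'rV[int]_d) (S : {set 'I_n}) (x : 'rV[rat]_d) :
  #|S| = d -> \det (rows_mx v S) != 0 ->
  exists2 c : 'I_n -> rat, forall i, i \notin S -> c i = 0 & x = \sum_i c i *: ratv (v i).
Proof.
move=> cS; have [g [_ gS Sg ->]] := rows_mx_enum v cS => dV.
pose A : 'M[rat]_d := map_mx intr (rows_at v g).
have uA : A \in unitmx by rewrite unitmxE det_map_mx unitfE intr_eq0.
pose u := x *m invmx A.
exists (fun i => \sum_(a | g a == i) u 0 a) => [i iS|].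
  by rewrite big1 // => a /eqP gai; rewrite -gai gS in iS.
transitivity (u *m A); first by rewrite mulmxKV.
rewrite mulmx_sum_row (partition_big g predT) //=; apply: eq_bigr => i _.
rewrite scaler_suml; apply: eq_bigr => a /eqP <-; congr (_ *: _).
by apply/rowP => c; rewrite !mxE.
Qed.

Lemma sum_weights_mul (d n : nat) (v : 'I_n -> 'rV[int]_d) (l : 'cV[rat]_d) (t y : 'I_n -> rat)
    (S : {set 'I_n}) :
  (forall i, i \notin S -> t i = 0) ->
  (forall i, i \in S -> (ratv (v i) *m l) 0 0 = y i) ->
  ((\sum_i t i *: ratv (v i)) *m l) 0 0 = \sum_i t i * y i.
Proof.
move=> tS lS; rewrite mulmx_suml summxE; apply: eq_bigr => i _.
rewrite -scalemxAl mxE; have [/lS -> // | /tS ->] := boolP (i \in S).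
by rewrite !mul0r.
Qed.

Lemma weights_inj (d n : nat) (v : 'I_n -> 'rV[int]_d) (S : {set 'I_n}) (t t' : 'I_n -> rat) :
  #|S| = d -> \det (rows_mx v S) != 0 ->
  (forall i, i \notin S -> t i = 0) -> (forall i, i \notin S -> t' i = 0) ->
  \sum_i t i *: ratv (v i) = \sum_i t' i *: ratv (v i) -> t =1 t'.
Proof.
move=> cS dS tS t'S tt' i; have [iS | iS] := boolP (i \in S); last by rewrite tS ?t'S.
have [l lS] := exists_functional (fun j => (j == i)%:R) cS dS.
have sumi (s : 'I_n -> rat) : \sum_j s j * (j == i)%:R = s i.
  rewrite (bigD1 i) //= eqxx mulr1 big1 ?addr0 // => j /negbTE ->.
  by rewrite mulr0.
by rewrite -(sumi t) -(sumi t') -(sum_weights_mul tS lS) -(sum_weights_mul t'S lS) tt'.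
Qed.

Lemma in_Delta_towards (d n : nat) (v : 'I_n -> 'rV[int]_d) (j : 'I_n) (t : 'I_n -> rat) (eps : rat) :
  0 <= eps <= 1 -> (forall i, 0 <= t i) -> \sum_i t i = 1 ->
  in_Delta v ((1 - eps) *: (\sum_i t i *: ratv (v i)) + eps *: ratv (v j)).
Proof.
move=> /andP[e0 e1] t0 t1; exists (fun i => (1 - eps) * t i + eps * (i == j)%:R); split.
- by move=> i; rewrite addr_ge0 ?mulr_ge0 ?subr_ge0 ?ler0n.
- rewrite big_split /= -!mulr_sumr t1 (bigD1 j) //= eqxx big1 => [|i /negbTE -> //].
  by rewrite addr0 !mulr1 subrK.
under [RHS]eq_bigr => i _ do rewrite scalerDl -!scalerA.
rewrite big_split /= -!scaler_sumr; congr (_ + _ *: _).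
by rewrite (bigD1 j) //= eqxx scale1r big1 ?addr0 // => i /negbTE ->; rewrite scale0r.
Qed.

(* Convexity of the gauge of [Delta]: pushing the barycenter of a facet simplex
   slightly towards [v j] stays in [Delta] and in the open cone over [S], hence
   in the simplex of [S] itself. *)
Lemma facet_functional_le1 (d n : nat) (v : 'I_n -> 'rV[int]_d) (T : {set {set 'I_n}})
    (S : {set 'I_n}) (l : 'cV[rat]_d) :
  triangulation v T -> S \in T ->
  (forall i, i \in S -> (ratv (v i) *m l) 0 0 = 1) ->
  forall j, (ratv (v j) *m l) 0 0 <= 1.
Proof.
case=> TS Tcov Tint _ ST lS j; have [cS dS] := TS S ST.
(* The barycenter below has weights [1/d]; for [d = 0] every functional vanishes. *)
case: (posnP d) => [d0 | d_gt0].
  rewrite mxE big1 ?ler01 // => c _.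
  by have := ltn_ord c; rewrite [X in (_ < X)%N]d0.
rewrite leNgt; apply/negP => lj_gt1.
have d0 : 0 < d%:R :> rat by rewrite ltr0n.
have [c cS0 vjE] := cone_coordinates (ratv (v j)) cS dS.
pose bc (i : 'I_n) : rat := if i \in S then d%:R^-1 else 0.
have bcS i : i \notin S -> bc i = 0 by rewrite /bc => /negbTE ->.
have bc0 i : 0 <= bc i by rewrite /bc; case: ifP => // _; rewrite invr_ge0 ltW.
have bc1 : \sum_i bc i = 1.
  by rewrite /bc -big_mkcond /= sumr_const cS -[LHS]mulr_natl mulfV ?gt_eqF.
pose Cc := \sum_i `|c i|; have Cc0 : 0 <= Cc by apply: sumr_ge0.
have cC i : - c i <= Cc.
  rewrite (le_trans (ler_norm _)) // normrN /Cc (bigD1 i) //= lerDl.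
  exact: sumr_ge0.
(* Then [d] times a coordinate of [y] on [S] is at least [1 - eps - eps * d * Cc = eps], hence
   positive. *)
pose eps := (2 + d%:R * Cc)^-1.
have den0 : 0 < 2 + d%:R * Cc by rewrite ltr_wpDr // mulr_ge0 // ltW.
have e0 : 0 < eps by rewrite invr_gt0.
have eE : eps * (2 + d%:R * Cc) = 1 by rewrite mulVf // gt_eqF.
have e1 : eps < 1.
  rewrite invf_lt1 // (@lt_le_trans _ _ 2) // lerDl mulr_ge0 // ltW.
pose y := (1 - eps) *: (\sum_i bc i *: ratv (v i)) + eps *: ratv (v j).
pose yc i := (1 - eps) * bc i + eps * c i.
have ycS i : i \notin S -> yc i = 0 by move=> iS; rewrite /yc bcS // cS0 // !mulr0 addr0.
have yc_gt0 i : i \in S -> 0 < yc i.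
  move=> iS; rewrite /yc /bc iS -(pmulr_rgt0 _ d0) mulrDr mulrCA mulfV ?gt_eqF // mulr1.
  have := ler_wpM2l (ltW (mulr_gt0 d0 e0)) (cC i); nra.
have yc_ge0 i : 0 <= yc i.
  by have [/yc_gt0/ltW | /ycS ->] := boolP (i \in S).
have yE : y = \sum_i yc i *: ratv (v i).
  rewrite /y [in X in _ + X]vjE !scaler_sumr -big_split; apply: eq_bigr => i _.
  by rewrite /= /yc [RHS]scalerDl !scalerA.
have yl : (y *m l) 0 0 = \sum_i yc i.
  by rewrite yE (sum_weights_mul ycS lS); apply: eq_bigr => i _; rewrite mulr1.
(* The total weight of [y] is its value under [l], a mean of 1 and a number above 1. *)
have s_gt1 : 1 < \sum_i yc i.
  rewrite -yl /y mulmxDl -!scalemxAl mxE [X in X + _]mxE [X in _ + X]mxE.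
  rewrite (sum_weights_mul bcS lS).
  under eq_bigr do rewrite mulr1.
  by rewrite bc1; move: e0 lj_gt1; set lj := (_ *m _) 0 0; nra.
set s := \sum_i yc i in yl s_gt1; have s0 : 0 < s by rewrite (lt_trans _ s_gt1).
have e01 : 0 <= eps <= 1 by rewrite !ltW.
have [S' S'T [t [t0 tS' t1 yt]]] := Tcov y (in_Delta_towards v j e01 bc0 bc1).
have [cS' _] := TS S' S'T.
have yS : in_simplex0 v S (s^-1 *: y).
  exists (fun i => s^-1 * yc i); split.
  - by move=> i; rewrite mulr_ge0 // invr_ge0 ltW.
  - by move=> i iS; rewrite ycS // mulr0.
  - by rewrite -mulr_sumr mulVf // gt_eqF.
  - by rewrite yE scaler_sumr; apply: eq_bigr => i _; rewrite scalerA.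
have yS' : in_simplex0 v S' (s^-1 *: y).
  exists (fun i => s^-1 * t i); split.
  - by move=> i; rewrite mulr_ge0 // invr_ge0 ltW.
  - by move=> i iS; rewrite tS' // mulr0.
  - rewrite -mulr_sumr ler_pdivrMl // mulr1; exact: le_trans t1 (ltW s_gt1).
  - by rewrite yt scaler_sumr; apply: eq_bigr => i _; rewrite scalerA.
have [t' [_ t'I _ yt']] := Tint S S' _ ST S'T yS yS'.
have t'S i : i \notin S -> t' i = 0 by move=> iS; apply: t'I; rewrite inE (negbTE iS).
have t'E : t' =1 (fun i => s^-1 * yc i).
  apply: (weights_inj cS dS t'S) => [i iS|]; first by rewrite ycS // mulr0.
  by rewrite -yt' yE scaler_sumr; apply: eq_bigr => i _; rewrite scalerA.
(* All weights of [y] on [S] are positive, while the common face carries them only on the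
   intersection. *)
have SS' : S = S'.
  apply/eqP; rewrite eqEcard cS cS' leqnn andbT; apply/subsetP => i iS.
  apply/negPn/negP => iS'; have := t'E i; rewrite t'I ?inE ?(negbTE iS') ?andbF // => /esym/eqP.
  by rewrite mulf_eq0 invr_eq0 !gt_eqF ?yc_gt0.
have : (y *m l) 0 0 <= 1.
  rewrite yt (sum_weights_mul (y := fun=> 1) _ lS) => [|i]; last by rewrite SS'; exact: tS'.
  by under eq_bigr do rewrite mulr1.
by rewrite yl leNgt s_gt1.
Qed.

(** * Coefficients of the generating function *)

Lemma Vol_sq (r m : nat) (w : 'I_m -> 'rV[int]_r) (I : 'I_r -> 'I_m) (J : {set 'I_m}) :
  injective I -> #|J| = r -> (forall a, I a \in J) ->
  ((`|\det (rows_mx w J)|) ^+ 2)%:~R = (\det (rows_at (fun i => ratv (w i)) I)) ^+ 2.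
Proof.
move=> Iinj cJ IJ; have [g [ginj gJ Jg ->]] := rows_mx_enum w cJ.
have [s Es] := det_rows_at_inj (fun i => ratv (w i)) Iinj ginj (fun a =>
  let: ex_intro b e := Jg _ (IJ a) in ex_intro _ b (esym e)).
rewrite Es exprMn sqrr_sign mul1r real_normK ?num_real // rmorphXn /= -det_map_mx.
by congr (\det _ ^+ 2); apply/matrixP => a c; rewrite !mxE.
Qed.

Definition tail (n : nat) (J : {set 'I_n.+1}) : {set 'I_n} := [set i | lift ord0 i \in J].

Definition cone0 (n : nat) (S : {set 'I_n}) : {set 'I_n.+1} := ord0 |: lift ord0 @: S.

Lemma tail_cone0 (n : nat) (S : {set 'I_n}) : tail (cone0 S) = S.
Proof.
apply/setP => i; rewrite !inE eq_sym (negbTE (neq_lift _ _)) /=.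
by rewrite mem_imset //; exact: lift_inj.
Qed.

Lemma cone0_tail (n : nat) (J : {set 'I_n.+1}) : ord0 \in J -> cone0 (tail J) = J.
Proof.
move=> J0; apply/setP => i; rewrite !inE; case: (unliftP ord0 i) => [i'|] ->.
  by rewrite eq_sym (negbTE (neq_lift _ _)) /= mem_imset ?inE //; exact: lift_inj.
by rewrite eqxx J0.
Qed.

Lemma card_tail (n : nat) (J : {set 'I_n.+1}) : #|J| = ((ord0 \in J) + #|tail J|)%N.
Proof.
rewrite -!sum1_card big_mkcond big_ord_recl /= [X in _ = (_ + X)%N]big_mkcond /=.
congr addn; apply: eq_bigr => i _; by rewrite inE.
Qed.

Lemma bv_lift (d n : nat) (v : 'I_n -> 'rV[int]_d) i : bv v (lift ord0 i) = row_mx (v i) 1.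
Proof. by rewrite /bv liftK. Qed.

Lemma bv_ord0 (d n : nat) (v : 'I_n -> 'rV[int]_d) : bv v ord0 = row_mx 0 1.
Proof. by rewrite /bv unlift_none. Qed.

(** With [v_0] as last row the matrix is block triangular, because [v_0] is [0] with last coordinate
    1. *)
Lemma Vol_cone0_sq (d n : nat) (v : 'I_n -> 'rV[int]_d) (S : {set 'I_n}) : #|S| = d ->
  (Vol_J v (cone0 S) ^+ 2)%:~R = ((`|\det (rows_mx v S)|) ^+ 2)%:~R :> rat.
Proof.
move=> cS; have [g [ginj gS _ _]] := rows_mx_enum v cS.
pose I (a : 'I_(d + 1)) : 'I_n.+1 := match split a with
  | inl a' => lift ord0 (g a') | inr _ => ord0 end.
have Il a : I (lshift 1 a) = lift ord0 (g a) by rewrite /I (unsplitK (inl a)).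
have Ir a : I (rshift d a) = ord0 by rewrite /I (unsplitK (inr a)).
have c0 : #|cone0 S| = (d + 1)%N.
  by rewrite card_tail tail_cone0 cS !inE eqxx addnC.
rewrite (@Vol_sq _ _ (bv v) I (cone0 S)) //; last first.
- move=> a; case: (split_ordP a) => a' ->; rewrite ?Il ?Ir !inE ?eqxx //.
  by rewrite mem_imset ?gS ?orbT //; exact: lift_inj.
- move=> a b; case: (split_ordP a) => a' ->; case: (split_ordP b) => b' ->; rewrite ?Il ?Ir.
  + by move=> /lift_inj/ginj ->.
  + by move/eqP; rewrite eq_sym (negbTE (neq_lift _ _)).
  + by move/eqP; rewrite (negbTE (neq_lift _ _)).
  + by rewrite (ord1 a') (ord1 b').
rewrite (Vol_sq v ginj cS gS); congr (_ ^+ 2).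
have -> : rows_at (fun i => ratv (bv v i)) I =
    block_mx (rows_at (fun i => ratv (v i)) g) (const_mx 1) 0 1%:M.
  apply/matrixP => a c; rewrite mxE.
  case: (split_ordP a) => a' ->; case: (split_ordP c) => c' ->.
  + by rewrite block_mxEul Il bv_lift mxE row_mxEl 2!mxE.
  + by rewrite block_mxEur Il bv_lift mxE row_mxEr !mxE (ord1 c').
  + by rewrite block_mxEdl Ir bv_ord0 mxE row_mxEl !mxE.
  + by rewrite block_mxEdr Ir bv_ord0 mxE row_mxEr !mxE (ord1 a') (ord1 c').
by rewrite det_ublock det1 mulr1.
Qed.

(** Here [a^e] is the monomial after multiplication by the [a_i], [i] in [J]. Adding [P_J] back
    makes the lattice condition independent of [J]; only [b0] remembers whether 0 is in [J]. *)
Lemma Psi_coefE (d n : nat) (v : 'I_n -> 'rV[int]_d)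
    (f : forall k : nat, {ffun 'I_n * 'I_k.+1 -> nat} -> rat)
    (J : {set 'I_n.+1}) (e : 'I_n -> int) :
  #|J| = (d + 1)%N ->
  let e' i := e i - (lift ord0 i \in J)%:Z in
  let b0 := 1 - \sum_i e i - (ord0 \in J)%:Z in
  Psi_coef v f (P_J v J) e' =
  if (\sum_i e i *: v i == 0) && (b0 <= 0) then int_Phi f b0 e' else 0.
Proof.
move=> cJ e' b0; rewrite /Psi_coef.
have tE : \sum_i (lift ord0 i \in J)%:Z = #|tail J|%:Z.
  rewrite -sum1_card -natz natr_sum [RHS]big_mkcond /=; apply: eq_bigr => i _.
  by rewrite inE; case: (_ \in _).
have lastP : P_J v J 0 (rshift d ord0) = d%:Z.
  have last1 i : bv v i 0 (rshift d ord0) = 1 by rewrite /bv row_mxEr mxE.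
  rewrite /P_J mxE summxE [X in _ + X]mxE last1.
  under eq_bigr => i _ do rewrite last1.
  by rewrite sumr_const cJ natz PoszD addrK.
have b0E : - P_J v J 0 (rshift d ord0) - \sum_i e' i = b0.
  rewrite lastP /b0 sumrB tE.
  have := card_tail J; rewrite cJ; move: (\sum_i e i) #|tail J| => s t.
  by case: (ord0 \in J) => /=; lia.
rewrite b0E; congr (if _ && _ then _ else _).
have sumE : \sum_(i < n.+1) match unlift ord0 i with Some i' => e' i' | None => b0 end *: bv v i
    + P_J v J = row_mx (\sum_i e i *: v i) 0.
  transitivity (\sum_i e i *: row_mx (v i) 1 - (\sum_i e i) *: bv v ord0).
    rewrite /P_J [X in _ + (X - _)]big_mkcond addrA -big_split big_ord_recl /= unlift_none.
    under eq_bigr => i _ do rewrite liftK bv_lift.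
    have -> : (if ord0 \in J then bv v ord0 else 0) = (ord0 \in J)%:Z *: bv v ord0.
      by case: (_ \in _); rewrite ?scale1r ?scale0r.
    rewrite addrC addrA -scalerDl -[- bv v ord0]scaleN1r -scalerDl addrC; congr (_ + _).
      apply: eq_bigr => i _; rewrite /e'; case: (_ \in _); last by rewrite subr0 addr0.
      by rewrite scalerBl scale1r subrK.
    by rewrite -scaleNr; congr (_ *: _); rewrite /b0; ring.
  rewrite bv_ord0; apply/rowP => c; rewrite 2!mxE summxE.
  case: (split_ordP c) => c' ->.
    rewrite row_mxEl [X in _ - X]mxE row_mxEl mxE mulr0 subr0 summxE.
    by apply: eq_bigr => i _; rewrite mxE row_mxEl [RHS]mxE.
  rewrite row_mxEr [X in _ - X]mxE row_mxEr [X in _ * X]mxE (ord1 c') mulr1 mxE.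
  apply/eqP; rewrite subr_eq0; apply/eqP; apply: eq_bigr => i _.
  by rewrite mxE row_mxEr mxE mulr1.
apply/eqP/eqP => [E | E].
  by move: sumE; rewrite E addNr -row_mx0 => /eq_row_mx[<-].
by apply/eqP; rewrite -addr_eq0 sumE E row_mx0.
Qed.

Lemma mpolyX_sum (n : nat) (I : finType) (P : pred I) (F : I -> 'X_{1..n}) :
  'X_[\sum_(i | P i) F i] = \prod_(i | P i) 'X_[F i] :> {mpoly rat[n]}.
Proof. exact: (big_morph _ (@mpolyXD n rat) (@mpolyX0 n rat)). Qed.

Definition divisor (n : nat) (i : 'I_n.+1) : {mpoly rat[n]} :=
  match unlift ord0 i with Some i' => 'X_i' | None => - \sum_(i < n) 'X_i end.

Lemma prod_divisor (n : nat) (J : {set 'I_n.+1}) :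
  \prod_(i in J) divisor i =
  (- \sum_(i < n) 'X_i) ^+ (ord0 \in J) * \prod_(i in tail J) 'X_i.
Proof.
rewrite big_mkcond big_ord_recl /= {1}/divisor unlift_none.
congr (_ * _); first by case: (ord0 \in J).
by rewrite [RHS]big_mkcond; apply: eq_bigr => i _; rewrite inE /divisor liftK.
Qed.

Section Coefficients.

Variables (d n : nat) (v : 'I_n -> 'rV[int]_d) (T : {set {set 'I_n}}).
Variable f : forall k : nat, {ffun 'I_n * 'I_k.+1 -> nat} -> rat.
Arguments f k : clear implicits.
Hypothesis triT : triangulation v T.
Hypothesis tf : forall k : nat, toric_integral (ray_k v (k := k)) (@cone_k n k T) (f k).

Let TS S : S \in T -> #|S| = d /\ \det (rows_mx v S) != 0.
Proof. by case: triT => TS _ _ _; exact: TS. Qed.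

(** The representative in [A_K] of the product of the [D_i^(-e_i)], the factor shared by all [J]. *)
Definition expo (K : nat) (e : 'I_n -> int) : {mpoly rat[n]} :=
  \prod_(i < n) 'X_i ^+ absz (K%:Z - e i).

Lemma int_Phi_tail (K : nat) (e : 'I_n -> int) b0 (J : {set 'I_n.+1}) :
  (forall i, absz (e i) < K)%N ->
  int_Phi f b0 (fun i => e i - (lift ord0 i \in J)%:Z) =
  int_Ak (f K) (expo K e * ((- \sum_(i < n) 'X_i) ^+ absz b0 * \prod_(i in tail J) 'X_i)).
Proof.
(* The strict bound on [e] leaves room for [e i - 1], whose absolute value may be [K]. *)
move=> eK; rewrite (int_PhiE TS tf (K := K)) => [|i]; last first.
  by have := eK i; case: (_ \in J) => /=; lia.
congr (int_Ak _ _); rewrite mulrCA; congr (_ * _).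
rewrite [X in _ * X]big_mkcond -big_split /=; apply: eq_bigr => i _.
rewrite inE; case: (_ \in J); last by rewrite subr0 mulr1.
by rewrite -exprSr; congr (_ ^+ _); have := eK i; lia.
Qed.

Lemma int_Ak_lin_mul (K : nat) (q p : {mpoly rat[n]}) c :
  \sum_i ratv (v i) 0 c * int_Ak (f K) (q * (p * 'X_i)) = 0.
Proof.
rewrite -[RHS](int_Ak_lin (@tf K) (q * p) c); apply: eq_bigr => i _.
by rewrite mxE mulrA.
Qed.

(** All bold vectors have last coordinate 1, so [x = v_0] is admissible for every [I]. In the linear
    relation the last coordinate vanishes by the definition of [D_0]. *)
Lemma int_Ak_gram_bv (K : nat) (q : {mpoly rat[n]}) :
  \sum_(J : {set 'I_n.+1} | #|J| == (d + 1)%N)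
    ((Vol_J v J) ^+ 2)%:~R * int_Ak (f K) (q * \prod_(i in J) divisor i) = 0.
Proof.
apply: (@gram_sum_eq0 _ _ (fun i => ratv (bv v i)) _ (@divisor n)
  (fun p => int_Ak (f K) (q * p)) (ratv (bv v ord0))) => [p c|I Iinj _ _|I J Iinj cJ IJ].
- rewrite big_ord_recl.
  have divl i : divisor (lift ord0 i) = 'X_i by rewrite /divisor liftK.
  case: (split_ordP c) => c' ->.
    rewrite [ratv _ _ _]mxE bv_ord0 row_mxEl mxE mul0r add0r -[RHS](int_Ak_lin_mul K q p c').
    by apply: eq_bigr => i _; rewrite [ratv _ _ _]mxE bv_lift row_mxEl divl [in RHS]mxE.
  rewrite [ratv _ _ _]mxE bv_ord0 row_mxEr mxE (ord1 c') mul1r.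
  under eq_bigr => i _ do rewrite [ratv _ _ _]mxE bv_lift row_mxEr mxE divl mul1r.
  rewrite -int_Ak_sum -int_AkD -!mulr_sumr -!mulrDr.
  by rewrite /divisor unlift_none addNr !mulr0 int_Ak0.
- have bvl i : ratv (bv v i) *m delta_mx (rshift d ord0) 0 = const_mx 1 :> 'M_1.
    apply/matrixP => a b; rewrite -colE 2!mxE /bv row_mxEr.
    by rewrite !mxE (ord1 a).
  by exists (delta_mx (rshift d ord0) 0).
- exact: Vol_sq.
Qed.

(** A nonzero integral puts every [i] with [e i < 0] in one simplex [S]. The functional that is 1 on
    [S] turns out to be 1 at every [v i] with [e i] nonzero, hence at [x] and at all chosen rows. *)
Lemma int_Ak_gram_v (K : nat) (e : 'I_n -> int) :
  (exists i, e i != 0) -> \sum_i e i *: v i = 0 -> \sum_i e i = 0 ->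
  (forall i, absz (e i) < K)%N ->
  \sum_(J : {set 'I_n} | #|J| == d)
    ((`|\det (rows_mx v J)|) ^+ 2)%:~R * int_Ak (f K) (expo K e * \prod_(i in J) 'X_i) = 0.
Proof.
move=> [i1 ei1] ev0 e0 eK.
pose neg i : rat := if e i < 0 then - (e i)%:~R else 0.
have neg_ge0 i : 0 <= neg i.
  by rewrite /neg; case: ltP => // ei; rewrite oppr_ge0 lerz0 ltW.
have sneg : \sum_i neg i != 0.
  apply/negP => /eqP sneg0.
  have eN i : 0 <= e i.
    rewrite leNgt; apply/negP => ei.
    have /eqP := psumr_eq0P (fun i _ => neg_ge0 i) sneg0 (i := i) isT.
    by rewrite /neg ei oppr_eq0 intr_eq0 lt_eqF.
  by move/negP: ei1; apply; apply/eqP; exact: (psumr_eq0P (fun i _ => eN i) e0).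
pose x := (\sum_i neg i)^-1 *: \sum_i neg i *: ratv (v i).
apply: (@gram_sum_eq0 _ _ (fun i => ratv (v i)) _ (fun i => 'X_i)
  (fun p => int_Ak (f K) (expo K e * p)) x) => [p c|I Iinj _ LI|I J Iinj cJ IJ].
- exact: int_Ak_lin_mul.
- pose m := ([multinom absz (K%:Z - e i) | i < n] + \sum_a U_(I a))%MM.
  have mE : expo K e * \prod_a 'X_(I a) = 'X_[m].
    rewrite mpolyXD mpolyX_sum; congr (_ * _).
    by rewrite mpolyXE_id; apply: eq_bigr => i _; rewrite mnmE.
  have [/existsP[S /andP[ST /subsetP mS]] | ] :=
    boolP [exists S in T, [set i | (K < m i)%N] \subset S]; last first.
    by move=> nc; move: LI; rewrite mE (int_Ak_noncone (@tf K)) ?eqxx.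
  have mi i : m i = (absz (K%:Z - e i) + \sum_a (I a == i))%N.
    by rewrite mnmDE mnmE mnm_sumE; congr addn; apply: eq_bigr => a _; rewrite mnm1E.
  (* The exponent [K - e i] exceeds [K] when [e i < 0]; when [e i = 0], the factor coming from [I]
     lifts it above [K]. *)
  have negS i : e i < 0 -> i \in S.
    by move=> ei; apply: mS; rewrite inE mi; lia.
  have IS a : e (I a) <= 0 -> I a \in S.
    move=> ei; apply: mS; rewrite inE mi (bigD1 a) //= eqxx /=; lia.
  have [cS dS] := TS ST.
  have [l lS] := exists_functional (fun=> 1) cS dS.
  have l_le1 := facet_functional_le1 triT ST lS.
  have neg0 i : i \notin S -> neg i = 0.
    by rewrite /neg; case: ltP => // /negS ->.
  (* Terms with [e i < 0] vanish since [v i] is on the facet, those with [e i > 0] are nonnegative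
     by [l_le1]. As the sum is 0, every term vanishes. *)
  have term0 i : 0 <= (e i)%:~R * (1 - (ratv (v i) *m l) 0 0) :> rat.
    case: (ltgtP (e i) 0) => [/negS/lS ->|ei|->]; rewrite ?subrr ?mulr0 ?mul0r //.
    by rewrite mulr_ge0 ?subr_ge0 // ler0z ltW.
  have terms0 : \sum_i (e i)%:~R * (1 - (ratv (v i) *m l) 0 0) = 0 :> rat.
    under eq_bigr do rewrite mulrBr mulr1.
    rewrite sumrB -rmorph_sum e0 sub0r.
    have -> : \sum_i (e i)%:~R * (ratv (v i) *m l) 0 0 = (ratv (\sum_i e i *: v i) *m l) 0 0.
      rewrite /ratv raddf_sum mulmx_suml summxE; apply: eq_bigr => i _.
      by rewrite /= map_mxZ -scalemxAl [RHS]mxE.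
    by rewrite ev0 /ratv map_mx0 mul0mx mxE oppr0.
  have to_mx (y : 'rV[rat]_d) : (y *m l) 0 0 = 1 -> y *m l = const_mx 1.
    by move=> yl; apply/matrixP => a b; rewrite !ord1 yl mxE.
  exists l => [a|]; apply: to_mx.
    case: (leP (e (I a)) 0) => [/IS/lS // | ei].
    have /eqP := psumr_eq0P (fun i _ => term0 i) terms0 (i := I a) isT.
    by rewrite mulf_eq0 intr_eq0 gt_eqF //= subr_eq0 => /eqP.
  rewrite -scalemxAl mxE (sum_weights_mul neg0 lS).
  under [X in _ * X]eq_bigr do rewrite mulr1.
  by rewrite mulVf.
- exact: Vol_sq.
Qed.

(** The shift by the indicator of [J] absorbs the product of the [a_i]; the index 0 causes none
    since [a_0 = 1]. *)
Definition coef (e : 'I_n -> int) : rat :=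
  \sum_(J : {set 'I_n.+1} | #|J| == (d + 1)%N)
    ((Vol_J v J) ^+ 2)%:~R *
    Psi_coef v f (P_J v J) (fun i => e i - (lift ord0 i \in J)%:Z).

Lemma coef_level1 (K : nat) (e : 'I_n -> int) :
  \sum_i e i *: v i = 0 -> \sum_i e i = 0 -> (forall i, absz (e i) < K)%N ->
  coef e = \sum_(J : {set 'I_n} | #|J| == d)
    ((`|\det (rows_mx v J)|) ^+ 2)%:~R * int_Ak (f K) (expo K e * \prod_(i in J) 'X_i).
Proof.
move=> ev0 e0 eK; rewrite /coef (bigID (fun J : {set 'I_n.+1} => ord0 \in J)) /=.
(* If 0 is not in [J], then [b0 = 1], which [b0 <= 0] excludes. *)
rewrite [X in _ + X]big1 ?addr0 => [|J /andP[/eqP cJ nJ]]; last first.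
  by rewrite Psi_coefE // e0 (negbTE nJ) ev0 eqxx mulr0.
rewrite (reindex_onto (@cone0 n) (@tail n)) => [|J /andP[_ /cone0_tail //]].
apply: eq_big => [J|J /andP[/andP[/eqP cJ J0] /eqP tJ]].
  by rewrite tail_cone0 eqxx card_tail tail_cone0 !inE eqxx andbT andbT addnC eqn_add2r.
have cJ' : #|J| = d.
  by move: cJ; rewrite card_tail tail_cone0 J0 addnC => /addIn.
rewrite Psi_coefE // ev0 eqxx e0 J0 subr0 subrr /= Vol_cone0_sq // (int_Phi_tail _ _ eK).
by rewrite tail_cone0 expr0 mul1r.
Qed.

Lemma coef_neq0 (e : 'I_n -> int) : (exists i, e i != 0) -> coef e = 0.
Proof.
move=> eN0; pose K := (\max_i absz (e i)).+1.
have eK i : (absz (e i) < K)%N by rewrite ltnS; exact: (leq_bigmax i).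
have [ev0|ev0] := eqVneq (\sum_i e i *: v i) 0; last first.
  by rewrite /coef big1 // => J /eqP cJ; rewrite Psi_coefE // (negbTE ev0) mulr0.
case: (ltgtP (\sum_i e i) 0) => s.
(* Here [b0 >= 1] for every [J]. *)
- rewrite /coef big1 // => J /eqP cJ; rewrite Psi_coefE // ev0 eqxx /= ifF ?mulr0 //.
  by apply/negbTE; move: s; move: (\sum_i e i) => s; case: (_ \in J) => /=; lia.
(* Every [J] has [b0 <= 0]. The common power of [D_0] is [sum e - 1]; those [J] that contain 0
   supply one more factor. *)
- rewrite -[RHS](int_Ak_gram_bv K
    (expo K e * (- \sum_(i < n) 'X_i) ^+ absz (1 - \sum_i e i)%R)).
  apply: eq_bigr => J /eqP cJ; congr (_ * _); rewrite Psi_coefE // ev0 eqxx /= ifT; last first.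
    by move: s; move: (\sum_i e i) => s; case: (_ \in J) => /=; lia.
  rewrite (int_Phi_tail _ _ eK) prod_divisor -mulrA; congr (int_Ak _ (_ * _)).
  rewrite mulrA -exprD; congr (_ ^+ _ * _).
  by move: s; move: (\sum_i e i) => s; case: (_ \in J) => /=; lia.
- by rewrite (coef_level1 ev0 s eK) int_Ak_gram_v.
Qed.

Lemma coef_0 : coef (fun=> 0) = \sum_(S in T) (`|\det (rows_mx v S)|)%:~R.
Proof.
rewrite (@coef_level1 1); first last.
- by move=> i; rewrite absz0.
- by rewrite big1.
- by rewrite big1 // => i _; rewrite scale0r.
have topE (S : {set 'I_n}) : expo 1 (fun=> 0) * \prod_(i in S) 'X_i = 'X_[topmon 1 S].
  rewrite mpolyXE_id [X in _ * X]big_mkcond -big_split; apply: eq_bigr => i _.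
  by rewrite /= mnmE; case: (i \in S); rewrite ?mulr1.
rewrite (bigID (mem T)) /= [X in _ + X]big1 ?addr0 => [|J /andP[/eqP cJ JT]]; last first.
  rewrite topE (int_Ak_noncone (@tf 1)) ?mulr0 //.
  apply: contra JT => /existsP[S /andP[ST sub]]; have [cS _] := TS ST.
  suff -> : J = S by [].
  apply/eqP; rewrite eqEcard cS cJ leqnn andbT; apply: subset_trans sub.
  by apply/subsetP => i iJ; rewrite inE mnmE iJ.
apply: eq_big => [S|S /andP[/eqP cS ST]].
  by case: (boolP (S \in T)) => [/TS[-> _]|]; rewrite ?eqxx ?andbF.
rewrite topE (int_Ak_cone (@tf 1)) // rmorphXn /= expr2 mulfK // intr_eq0 normr_eq0.
by have [] := TS ST.
Qed.

End Coefficients.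

(** * Lattice points *)

Lemma absz_det_unitmx (d : nat) (L : 'M[int]_d) : L \in unitmx -> absz (\det L) = 1%N.
Proof.
move=> uL; have /(congr1 determinant) := mulmxV uL.
rewrite det_mulmx det1 => /(congr1 absz); rewrite abszM /= => /eqP.
by rewrite muln_eq1 => /andP[/eqP].
Qed.

Lemma card_dffun_ord (d : nat) (F : 'I_d -> nat) :
  #|{dffun forall i : 'I_d, 'I_(F i)}| = (\prod_i F i)%N.
Proof.
rewrite card_dep_ffun foldrE big_map -big_enum /=.
by apply: eq_bigr => i _; rewrite card_ord.
Qed.

Definition frac_row (d : nat) (t : 'rV[rat]_d) : 'rV[rat]_d :=
  \row_c (t 0 c - (Num.floor (t 0 c))%:~R).

Definition floor_row (d : nat) (t : 'rV[rat]_d) : 'rV[int]_d :=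
  \row_c Num.floor (t 0 c).

Lemma frac_rowE (d : nat) (t : 'rV[rat]_d) : t = frac_row t + ratv (floor_row t).
Proof. by apply/rowP => c; rewrite !mxE subrK. Qed.

Lemma floor_row_ratv (d : nat) (z : 'rV[int]_d) : floor_row (ratv z) = z.
Proof. by apply/rowP => c; rewrite !mxE intrKfloor. Qed.

Lemma ratvD (d : nat) (x y : 'rV[int]_d) : ratv (x + y) = ratv x + ratv y.
Proof. exact: map_mxD. Qed.

Lemma ratvB (d : nat) (x y : 'rV[int]_d) : ratv (x - y) = ratv x - ratv y.
Proof. exact: map_mxB. Qed.

Lemma ratvM (d : nat) (x : 'rV[int]_d) (M : 'M[int]_d) :
  ratv (x *m M) = ratv x *m map_mx intr M.
Proof. exact: map_mxM. Qed.

Lemma ratv_inj (d : nat) : injective (@ratv d).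
Proof.
by move=> x y /rowP xy; apply/rowP => c; have := xy c; rewrite !mxE => /intr_inj.
Qed.

(* Lattice points are represented by their coordinates in the rows of [M]; they
   are counted with the Smith normal form of [M]. *)
Lemma half_open_parallelepiped (d : nat) (M : 'M[int]_d) : \det M != 0 ->
  exists Th : seq 'rV[rat]_d,
    [/\ uniq Th, size Th = absz (\det M),
        forall t, t \in Th -> (forall c, 0 <= t 0 c < 1) /\
          exists x, t *m map_mx intr M = ratv x
      & forall x, exists2 t, t \in Th & exists z, ratv x = (t + ratv z) *m map_mx intr M].
Proof.
move=> dM; have [L uL [R uR [s _ ME]]] := int_Smith_normal_form M.
pose de := \row_(i < d) s`_i.
have {}ME : M = L *m diag_mx de *m R.
  by rewrite ME; congr (_ *m _ *m _); apply/matrixP => i j; rewrite !mxE.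
have detE : \det M = \det L * (\prod_i de 0 i) * \det R.
  by rewrite ME !det_mulmx det_diag.
have de0 i : de 0 i != 0.
  apply: contra dM => /eqP de0; rewrite detE (bigD1 i) //= de0.
  by rewrite mul0r mulr0 mul0r.
pose A : 'M[rat]_d := map_mx intr M.
have uA : A \in unitmx by rewrite unitmxE det_map_mx unitfE intr_eq0.
pose Y := {dffun forall i : 'I_d, 'I_(absz (de 0 i))}.
pose vy (y : Y) : 'rV[int]_d := \row_i (y i)%:Z.
(* Modulo the row lattice of [M], the classes are [y *m R] with [y] reduced modulo the elementary
   divisors; [ta y] is such a point in [M]-coordinates. *)
pose ta (y : Y) := ratv (vy y *m R) *m invmx A.
have taE y : ta y *m map_mx intr M = ratv (vy y *m R) by rewrite mulmxKV.
exists [seq frac_row (ta y) | y : Y]; split.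
- rewrite map_inj_uniq ?enum_uniq // => y y' tt.
  (* Equal fractional parts put the two points in the same class, so [y] and [y'] agree modulo the
     elementary divisors. *)
  have [z zE] : exists z, ta y - ta y' = ratv z.
    exists (floor_row (ta y) - floor_row (ta y')).
    by rewrite {1}(frac_rowE (ta y)) {1}(frac_rowE (ta y')) tt ratvB opprD addrACA subrr add0r.
  have : ratv ((vy y - vy y') *m R) = ratv (z *m M).
    by rewrite (ratvM z) -zE !mulmxBl !taE ratvB.
  move=> /ratv_inj; rewrite ME !mulmxA => /(can_inj (mulmxK uR)) yz.
  apply/ffunP => i; apply: val_inj => /=.
  have vyE u : vy u 0 i = (u i)%:Z by rewrite mxE.
  have /rowP/(_ i) := yz; rewrite mul_mx_diag mxE [X in _ + X]mxE !vyE [RHS]mxE => yzi.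
  have := ltn_ord (y i); have := ltn_ord (y' i); have := de0 i.
  have : (y i)%:Z - (y' i)%:Z \in dvdz (de 0 i) by rewrite yzi dvdz_mull.
  move: (de 0 i) (val (y i)) (val (y' i)) => D a b dvd D0 bD aD.
  have : (absz D %| absz (a%:Z - b%:Z))%N by [].
  have : (absz (a%:Z - b%:Z) < absz D)%N by lia.
  by case: (posnP (absz (a%:Z - b%:Z))) => [? _ _|? lt /dvdn_leq]; lia.
- rewrite size_map -cardE card_dffun_ord detE !abszM !absz_det_unitmx // mul1n muln1.
  by rewrite (big_morph absz abszM (erefl : absz 1 = 1%N)).
- move=> _ /mapP[y _ ->]; split=> [c|].
    rewrite mxE; have /andP[h1 h2] := floor_itv (ta y 0 c).
    by rewrite subr_ge0 h1 ltrBlDl -[1]/(1%:~R) -intrD.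
  exists (vy y *m R - floor_row (ta y) *m M); rewrite ratvB ratvM.
  have -> : frac_row (ta y) = ta y - ratv (floor_row (ta y)).
    by rewrite {2}(frac_rowE (ta y)) addrK.
  by rewrite mulmxBl taE !ratvM.
- move=> x; pose w := x *m invmx R.
  have yP i : exists j : 'I_(absz (de 0 i)), (val j)%:Z == modz (w 0 i) (de 0 i).
    have lt : (absz (modz (w 0%R i) (de 0%R i)) < absz (de 0%R i))%N.
      by have := modz_ge0 (w 0 i) (de0 i); have := ltz_mod (w 0 i) (de0 i); lia.
    by exists (Ordinal lt); rewrite /= gez0_abs // modz_ge0.
  have yP' i := sigW (yP i).
  pose y : Y := [ffun i => sval (yP' i)].
  have yE i : (y i)%:Z = modz (w 0 i) (de 0 i) by apply/eqP; rewrite ffunE; exact: (svalP (yP' i)).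
  pose q : 'rV[int]_d := \row_i divz (w 0 i) (de 0 i).
  exists (frac_row (ta y)); first by apply: map_f; rewrite mem_enum.
  exists (floor_row (ta y) + q *m invmx L); rewrite ratvD addrA -frac_rowE mulmxDl.
  rewrite taE -ratvM -ratvD; congr ratv.
  rewrite ME !mulmxA mulmxKV // -mulmxDl.
  suff -> : vy y + q *m diag_mx de = w by rewrite mulmxKV.
  by apply/rowP => i; rewrite mul_mx_diag mxE [vy y 0 i]mxE yE [X in _ + X]mxE [q 0 i]mxE addrC -divz_eq.
Qed.

Lemma sum_image (V : nmodType) (d n : nat) (g : 'I_d -> 'I_n) (S : {set 'I_n}) (F : 'I_n -> V) :
  injective g -> (forall a, g a \in S) -> (forall i, i \in S -> exists a, g a = i) ->
  (forall i, i \notin S -> F i = 0) -> \sum_i F i = \sum_a F (g a).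
Proof.
move=> ginj gS Sg F0; rewrite (bigID (mem S)) /= [X in _ + X]big1 ?addr0 //.
have -> : S = g @: [set: 'I_d].
  apply/setP => i; apply/idP/imsetP => [/Sg[a <-]|[a _ ->] //].
  by exists a.
rewrite big_imset /=; last by move=> a b _ _; exact: ginj.
by apply: eq_bigl => a; rewrite inE.
Qed.

Definition ratrows (d n : nat) (v : 'I_n -> 'rV[int]_d) (S : {set 'I_n}) : 'M[rat]_d :=
  map_mx intr (rows_mx v S).

Lemma mul_rows_at (d n : nat) (v : 'I_n -> 'rV[int]_d) (g : 'I_d -> 'I_n) (u : 'rV[rat]_d) :
  u *m map_mx intr (rows_at v g) = \sum_a u 0 a *: ratv (v (g a)).
Proof.
rewrite mulmx_sum_row; apply: eq_bigr => a _; congr (_ *: _).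
by apply/rowP => c; rewrite !mxE.
Qed.

Lemma simplex_row (d n : nat) (v : 'I_n -> 'rV[int]_d) (S : {set 'I_n}) (x : 'rV[rat]_d) :
  #|S| = d -> in_simplex0 v S x ->
  exists u : 'rV[rat]_d, [/\ forall c, 0 <= u 0 c, \sum_c u 0 c <= 1 & x = u *m ratrows v S].
Proof.
move=> cS [t [t0 tS t1 ->]]; rewrite /ratrows.
have [g [ginj gS Sg ->]] := rows_mx_enum v cS.
exists (\row_a t (g a)); split=> [c||]; first by rewrite mxE.
  by under eq_bigr => a _ do rewrite mxE; rewrite -(sum_image ginj gS Sg tS).
rewrite mul_rows_at (sum_image ginj gS Sg) => [|i iS]; last by rewrite tS // scale0r.
by apply: eq_bigr => a _; rewrite mxE.
Qed.

Lemma row_simplex (d n : nat) (v : 'I_n -> 'rV[int]_d) (S : {set 'I_n}) (u : 'rV[rat]_d) :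
  #|S| = d -> (forall c, 0 < u 0 c) ->
  exists t : 'I_n -> rat, [/\ forall i, i \notin S -> t i = 0, forall i, i \in S -> 0 < t i,
    \sum_i t i = \sum_c u 0 c & u *m ratrows v S = \sum_i t i *: ratv (v i)].
Proof.
move=> cS u0; rewrite /ratrows; have [g [ginj gS Sg ->]] := rows_mx_enum v cS.
pose t i := if [pick a | g a == i] is Some a then u 0 a else 0.
have tg a : t (g a) = u 0 a.
  by rewrite /t; case: pickP => [b /eqP/ginj -> //|/(_ a)]; rewrite eqxx.
have tS i : i \notin S -> t i = 0.
  by rewrite /t; case: pickP => // a /eqP <-; rewrite gS.
exists t; split=> // [i /Sg[a <-]||]; first by rewrite tg.
  by rewrite (sum_image ginj gS Sg tS); apply: eq_bigr => a _; rewrite tg.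
rewrite mul_rows_at (sum_image ginj gS Sg) => [|i iS]; last by rewrite tS // scale0r.
by apply: eq_bigr => a _; rewrite tg.
Qed.

(** The weight missing from 1 is placed on the origin. *)
Lemma simplex_in_Delta (d n : nat) (v : 'I_n -> 'rV[int]_d) (S : {set 'I_n}) (x : 'rV[rat]_d) :
  in_Delta v 0 -> in_simplex0 v S x -> in_Delta v x.
Proof.
move=> [z [z0 z1 zv]] [t [t0 _ t1 ->]].
exists (fun i => t i + (1 - \sum_j t j) * z i); split.
- by move=> i; rewrite addr_ge0 // mulr_ge0 // subr_ge0.
- by rewrite big_split /= -mulr_sumr z1 mulr1 addrC subrK.
under [RHS]eq_bigr => i _ do rewrite scalerDl -scalerA.
by rewrite big_split /= -scaler_sumr -zv scaler0 addr0.
Qed.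

(** * Counting lattice points in dilates of [Delta] *)

Definition box (d N : nat) : {set d.-tuple 'I_N.+1} :=
  [set t : d.-tuple 'I_N.+1 | (\sum_(i <- t) i <= N)%N].

(** The offset [b] is 0 for the upper count; [b = 1] makes all coordinates positive for the lower
    count. *)
Definition box_row (d N : nat) (b : nat) (t : d.-tuple 'I_N.+1) : 'rV[int]_d :=
  \row_c (b + tnth t c)%N%:Z.

Lemma box_row_inj (d N b : nat) : injective (@box_row d N b).
Proof.
move=> t t' /rowP tt; apply: eq_from_tnth => c; have := tt c; rewrite !mxE => -[].
by move/addnI/val_inj.
Qed.

(** A triple is a simplex, a class of lattice points modulo its vertex lattice, and a translation in
    that lattice. *)
Definition points_index (d n : nat) (T : {set {set 'I_n}}) (Th : {set 'I_n} -> seq 'rV[rat]_d)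
    (N : nat) : seq ({set 'I_n} * ('rV[rat]_d * d.-tuple 'I_N.+1)) :=
  [seq (U, p) | U <- enum T, p <- [seq (th, t) | th <- Th U, t <- enum (box d N)]].

Lemma size_points_index (d n : nat) (T : {set {set 'I_n}}) (Th : {set 'I_n} -> seq 'rV[rat]_d) N :
  size (points_index T Th N) = ((\sum_(S in T) size (Th S)) * 'C(d + N, d))%N.
Proof.
rewrite /points_index size_allpairs_dep sumnE big_map big_enum /= big_distrl /=.
apply: eq_bigr => S _; rewrite size_allpairs -cardE; congr muln.
exact: card_partial_ord_partitions.
Qed.

Lemma mem_points_index (d n : nat) (T : {set {set 'I_n}}) (Th : {set 'I_n} -> seq 'rV[rat]_d)
    N S th (t : d.-tuple 'I_N.+1) :
  (S, (th, t)) \in points_index T Th N = [&& S \in T, th \in Th S & t \in box d N].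
Proof.
apply/allpairsPdep/and3P => [[S' [p [ST' /allpairsPdep[th' [t' [thT tB ->]]] [-> -> ->]]]]|[ST thT tB]].
  by rewrite !mem_enum in ST' tB.
exists S, (th, t); split; rewrite ?mem_enum //.
by apply/allpairsPdep; exists th, t; rewrite mem_enum.
Qed.

(** For representatives in [Th] the product is already integral; [floor_row] only converts it to an
    integer row. *)
Definition lattice_point (d n N : nat) (v : 'I_n -> 'rV[int]_d) (b : nat)
    (q : {set 'I_n} * ('rV[rat]_d * d.-tuple 'I_N.+1)) : 'rV[int]_d :=
  floor_row ((q.2.1 + ratv (box_row b q.2.2)) *m ratrows v q.1).

Section Counting.

Variables (d n : nat) (v : 'I_n -> 'rV[int]_d) (T : {set {set 'I_n}}).
Hypothesis triT : triangulation v T.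
Hypothesis zeroD : in_Delta v 0.

Let TS S : S \in T -> #|S| = d /\ \det (rows_mx v S) != 0.
Proof. by case: triT => TS _ _ _; exact: TS. Qed.

Let ratrows_unit S : S \in T -> ratrows v S \in unitmx.
Proof. by case/TS => _ dS; rewrite unitmxE det_map_mx unitfE intr_eq0. Qed.

Lemma exists_representatives : exists Th : {set 'I_n} -> seq 'rV[rat]_d,
  forall S, S \in T ->
    [/\ uniq (Th S), size (Th S) = absz (\det (rows_mx v S)),
        forall t, t \in Th S -> (forall c, 0 <= t 0 c < 1) /\
          exists x, t *m ratrows v S = ratv x
      & forall x, exists2 t, t \in Th S & exists z, ratv x = (t + ratv z) *m ratrows v S].
Proof.
have H S : exists th : seq 'rV[rat]_d, S \in T ->
    [/\ uniq th, size th = absz (\det (rows_mx v S)),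
        forall t, t \in th -> (forall c, 0 <= t 0 c < 1) /\
          exists x, t *m ratrows v S = ratv x
      & forall x, exists2 t, t \in th & exists z, ratv x = (t + ratv z) *m ratrows v S].
  have [/TS[_ dS]|nS] := boolP (S \in T); last by exists [::].
  by have [th thP] := half_open_parallelepiped dS; exists th.
exact: fin_all_exists H.
Qed.

Variable Th : {set 'I_n} -> seq 'rV[rat]_d.
Hypothesis ThP : forall S, S \in T ->
    [/\ uniq (Th S), size (Th S) = absz (\det (rows_mx v S)),
        forall t, t \in Th S -> (forall c, 0 <= t 0 c < 1) /\
          exists x, t *m ratrows v S = ratv x
      & forall x, exists2 t, t \in Th S & exists z, ratv x = (t + ratv z) *m ratrows v S].

(** Every lattice point of the dilate splits, in a simplex containing it, into a representative and
    a translation in the box. Points on shared faces may be hit repeatedly, which is harmless for an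
    upper bound. *)
Lemma points_upper (N : nat) (s : seq 'rV[int]_d) :
  (0 < N)%N -> uniq s -> (forall x, x \in s -> in_Delta v ((N%:R)^-1 *: ratv x)) ->
  (size s <= size (points_index T Th N))%N.
Proof.
move=> N0 us sD; have N0' : 0 < N%:R :> rat by rewrite ltr0n.
rewrite -(size_map (@lattice_point d n N v 0)); apply: uniq_leq_size => // x /sD xD.
case: triT => _ Tcov _ _; have [S ST xS] := Tcov _ xD; have [cS dS] := TS ST.
have [u [u0 u1 xu]] := simplex_row cS xS.
have [_ _ thP /(_ x)[th thS [z zE]]] := ThP ST.
have [th01 _] := thP th thS.
have uE : N%:R *: u = th + ratv z.
  apply: (can_inj (mulmxK (ratrows_unit ST))); rewrite -zE -scalemxAl -xu scalerA mulfV ?gt_eqF //.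
  by rewrite scale1r.
have uEc c : N%:R * u 0 c = th 0 c + (z 0 c)%:~R.
  by have /rowP/(_ c) := uE; rewrite !mxE.
(* A nonnegative number minus a fractional part below 1 exceeds -1. *)
have z0 c : 0 <= z 0 c.
  have : -1 < (z 0 c)%:~R :> rat.
    have /andP[_ th1] := th01 c; have := uEc c.
    by have := mulr_ge0 (ltW N0') (u0 c); lra.
  by rewrite -[-1]/((-1)%:~R) ltr_int; lia.
have sz : \sum_c (z 0 c)%:~R <= N%:R :> rat.
  apply: (@le_trans _ _ (\sum_c (N%:R * u 0 c))).
    by apply: ler_sum => c _; rewrite uEc lerDr; have /andP[] := th01 c.
  by rewrite -mulr_sumr ler_piMr // ltW.
have {}sz : (\sum_c absz (z 0 c)%R <= N)%N.
  rewrite -(ler_nat rat) natr_sum; apply: le_trans sz; apply: ler_sum => c _.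
  by rewrite -{2}(gez0_abs (z0 c)) -pmulrn.
have zN c : (absz (z 0 c)%R < N.+1)%N.
  by rewrite ltnS (leq_trans _ sz) // (bigD1 c) //= leq_addr.
pose t : d.-tuple 'I_N.+1 := [tuple Ordinal (zN c) | c < d].
have tz : box_row 0 t = z.
  by apply/rowP => c; rewrite mxE tnth_mktuple add0n /= gez0_abs.
apply/mapP; exists (S, (th, t)).
  rewrite mem_points_index ST thS inE big_tuple /=.
  by under eq_bigr => c _ do rewrite tnth_mktuple /=.
by rewrite /lattice_point /= tz -zE floor_row_ratv.
Qed.

(** The shift by 1 puts each point in the open cone over its simplex, so triples give distinct
    points. Fractional part and shift cost at most 2 per coordinate, whence the dilation
    [N + 2 * d]. *)
Lemma points_lower (N : nat) (s : seq 'rV[int]_d) :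
  (0 < N + 2 * d)%N -> (forall x, in_Delta v (((N + 2 * d)%:R)^-1 *: ratv x) -> x \in s) ->
  (size (points_index T Th N) <= size s)%N.
Proof.
move=> N0 sD; have N0' : 0 < (N + 2 * d)%:R :> rat by rewrite ltr0n.
set M := (N + 2 * d)%:R : rat.
pose u (q : {set 'I_n} * ('rV[rat]_d * d.-tuple 'I_N.+1)) : 'rV[rat]_d :=
  q.2.1 + ratv (box_row 1 q.2.2).
have ptE q : q \in points_index T Th N -> ratv (@lattice_point d n N v 1 q) = u q *m ratrows v q.1.
  case: q => S [th t]; rewrite mem_points_index => /and3P[ST thS _].
  have [_ _ /(_ th thS)[_ [x xE]] _] := ThP ST.
  rewrite /lattice_point /u /= mulmxDl xE -ratvM -ratvD floor_row_ratv.
  by [].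
have u_gt0 q : q \in points_index T Th N -> forall c, 0 < u q 0 c.
  case: q => S [th t]; rewrite mem_points_index => /and3P[ST thS _] c.
  have [_ _ /(_ th thS)[/(_ c)/andP[th0 _] _] _] := ThP ST.
  by rewrite /u !mxE ltr_wpDl // ltr0z.
have u_sum q : q \in points_index T Th N -> \sum_c u q 0 c <= M.
  case: q => S [th t]; rewrite mem_points_index => /and3P[ST thS]; rewrite inE => tB.
  have [_ _ /(_ th thS)[th01 _] _] := ThP ST.
  apply: (@le_trans _ _ (\sum_(c < d) (2 + (tnth t c)%:R))).
    apply: ler_sum => c _; rewrite !mxE /= -pmulrn natrD.
    by have /andP[_ /ltW] := th01 c; lra.
  rewrite big_split /= sumr_const card_ord -mulrnA -natr_sum /M -natrD ler_nat addnC leq_add2r.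
  by rewrite big_tuple in tB.
have uN q : q \in points_index T Th N -> exists t : 'I_n -> rat,
    [/\ in_simplex0 v q.1 (M^-1 *: ratv (@lattice_point d n N v 1 q)),
      forall i, i \notin q.1 -> t i = 0, forall i, i \in q.1 -> 0 < t i &
      M^-1 *: ratv (@lattice_point d n N v 1 q) = \sum_i t i *: ratv (v i)].
  move=> qI; have [ST _] : q.1 \in T /\ True.
    by case: (q) qI => S [th t]; rewrite mem_points_index => /and3P[].
  have [cS _] := TS ST.
  have Mu0 c : 0 < (M^-1 *: u q) 0 c by rewrite mxE mulr_gt0 ?invr_gt0 // u_gt0.
  have [t [tS t0 t1 tE]] := row_simplex v cS Mu0.
  have xE : M^-1 *: ratv (@lattice_point d n N v 1 q) = \sum_i t i *: ratv (v i).
    by rewrite ptE // scalemxAl tE.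
  exists t; split=> //; exists t; split=> // [i|].
    by have [/t0/ltW|/tS ->] := boolP (i \in q.1).
  rewrite t1; under eq_bigr => c _ do rewrite mxE.
  by rewrite -mulr_sumr ler_pdivrMl // mulr1 u_sum.
have uniqI : uniq (points_index T Th N).
  apply: allpairs_uniq_dep; first exact: enum_uniq.
    move=> S; rewrite mem_enum => ST; have [uT _ _ _] := ThP ST.
    apply: allpairs_uniq => //; first exact: enum_uniq.
    by move=> [a b] [a' b'] _ _ [-> ->].
  by move=> [S p] [S' p'] _ _ /= [-> ->].
rewrite -(size_map (@lattice_point d n N v 1)); apply: uniq_leq_size; last first.
  move=> _ /mapP[q qI ->]; apply: sD.
  by have [t [qS _ _ _]] := uN q qI; exact: simplex_in_Delta qS.
rewrite map_inj_in_uniq // => q q' qI q'I qq'.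
have [t [qS tS t0 tE]] := uN q qI; have [t' [q'S t'S t'0 t'E]] := uN q' q'I.
have inT p : p \in points_index T Th N -> p.1 \in T.
  by case: p => S [th r]; rewrite mem_points_index => /and3P[].
(* A common point has positive weights on all of each simplex but is supported on their
   intersection. *)
have Sq : q.1 = q'.1.
  have sub p p' : p \in points_index T Th N -> p' \in points_index T Th N ->
      lattice_point v 1 p = lattice_point v 1 p' -> p.1 \subset p'.1.
    move=> pI p'I pp'; have [r [pS rS r0 rE]] := uN p pI; have [_ [p'S _ _ _]] := uN p' p'I.
    rewrite -pp' in p'S.
    case: triT => _ _ Tint _.
    have [w [_ wI _ wE]] := Tint _ _ _ (inT p pI) (inT p' p'I) pS p'S.
    have [cS dS] := TS (inT p pI).
    have wS i : i \notin p.1 -> w i = 0 by move=> ip; apply: wI; rewrite inE (negbTE ip).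
    have rw : r =1 w by apply: (weights_inj cS dS rS wS); rewrite -rE -wE.
    apply/subsetP => i ip; apply/negPn/negP => ip'.
    by have := r0 i ip; rewrite rw wI ?ltxx // inE (negbTE ip') andbF.
  by apply/eqP; rewrite eqEsubset !sub.
have uu : u q = u q'.
  apply: (can_inj (mulmxK (ratrows_unit (inT q qI)))).
  by rewrite -ptE // qq' ptE // Sq.
case: q q' qI q'I Sq uu {qq' qS tS t0 tE q'S t'S t'0 t'E} => S [th r] [S' [th' r']] /=.
rewrite !mem_points_index => /and3P[ST thS _] /and3P[_ thS' _] SS'.
rewrite -SS' in thS' *; rewrite /u /= => uu.
have [_ _ thP _] := ThP ST; have [th01 _] := thP _ thS; have [th01' _] := thP _ thS'.
(* Both representatives have entries in [[0, 1)], so the integer parts agree. *)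
have rr : r = r'.
  apply: (@box_row_inj _ _ 1); apply/rowP => c; have /rowP/(_ c) := uu.
  rewrite 2![in LHS]mxE 2![in RHS]mxE; set z := box_row 1 r 0 c; set z' := box_row 1 r' 0 c.
  have := th01 c; have := th01' c; move: (th 0 c) (th' 0 c) z z' => a a' z z'.
  move=> /andP[h1 h2] /andP[h3 h4] az.
  have h5 : ((z - z')%:~R : rat) < 1%:~R by rewrite intrB; lra.
  have h6 : ((z' - z)%:~R : rat) < 1%:~R by rewrite intrB; lra.
  by move: h5 h6; rewrite !ltr_int; lia.
by move: uu; rewrite rr => /addIr ->.
Qed.

End Counting.

(** * Asymptotics of the counts *)

Lemma leq_pow (m n e : nat) : (m <= n)%N -> (m ^ e <= n ^ e)%N.
Proof. by move=> mn; elim: e => // e IHe; rewrite !expnS leq_mul. Qed.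

(** The right side is the chord of a convex function over [[0, 1]]. *)
Lemma exp1D_le (x : rat) (d : nat) : 0 <= x <= 1 -> (1 + x) ^+ d <= 1 + (2 ^+ d - 1) * x.
Proof.
move=> /andP[x0 x1]; elim: d => [|d IHd]; first by rewrite !expr0 subrr mul0r addr0.
rewrite !exprSr; have x10 : 0 <= 1 + x by rewrite addr_ge0.
apply: (le_trans (ler_wpM2r x10 IHd)).
have w1 : 1 <= 2 ^+ d :> rat by apply: exprn_ege1.
rewrite -subr_ge0 in w1; have x1' : 0 <= 1 - x by rewrite subr_ge0.
have := mulr_ge0 (mulr_ge0 w1 x0) x1'.
by move: (2 ^+ d) => w; lra.
Qed.

Lemma exp1B_ge (x : rat) (d : nat) : 0 <= x <= 1 -> 1 - d%:R * x <= (1 - x) ^+ d.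
Proof.
move=> /andP[x0 x1]; elim: d => [|d IHd]; first by rewrite mul0r subr0.
rewrite exprSr; have x10 : 0 <= 1 - x by rewrite subr_ge0.
apply: le_trans (ler_wpM2r x10 IHd); rewrite -natr1.
have d0 : 0 <= d%:R :> rat by [].
by have := mulr_ge0 d0 (sqr_ge0 x); rewrite expr2; move: (d%:R) => w; lra.
Qed.

(** The left side is the product of [N + 1, ..., N + d]. *)
Lemma fact_binD_le (d N : nat) : (d`! * 'C(d + N, d) <= (d + N) ^ d)%N.
Proof.
rewrite mulnC bin_ffact ffact_prod -[X in (_ <= _ ^ X)%N]card_ord -prod_nat_const.
by apply: leq_prod => i _; rewrite leq_subr.
Qed.

Lemma fact_binD_ge (d N : nat) : (N ^ d <= d`! * 'C(d + N, d))%N.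
Proof.
rewrite mulnC bin_ffact ffact_prod -[X in (_ ^ X <= _)%N]card_ord -prod_nat_const.
by apply: leq_prod => i _; have := ltn_ord i; lia.
Qed.

(** The normalized count lies between [A (1 - 2d/N)^d] and [A (1 + 2d/N)^d], where [A] is the total
    volume of the simplices. *)
Lemma normalized_volume_triangulation (d n : nat) (v : 'I_n -> 'rV[int]_d)
    (T : {set {set 'I_n}}) :
  triangulation v T -> in_Delta v 0 ->
  normalized_volume v (\sum_(S in T) (`|\det (rows_mx v S)|)%:~R).
Proof.
move=> triT zeroD; have [Th ThP] := exists_representatives triT.
set A := (\sum_(S in T) size (Th S))%N.
have -> : \sum_(S in T) (`|\det (rows_mx v S)|)%:~R = A%:R :> rat.
  rewrite /A natr_sum; apply: eq_bigr => S /ThP[_ -> _ _].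
  by rewrite pmulrn abszE.
move=> eps eps0; pose W : rat := 2 ^+ d.
have dW : d%:R <= W by rewrite /W -natrX ler_nat ltnW // ltn_expl.
have B0 : 0 <= A%:R * W * (2 * d)%:R / eps.
  by rewrite divr_ge0 ?mulr_ge0 ?exprn_ge0 // ltW.
(* The first bound gives [x = 2d/N <= 1], the second [A W x < eps], which dominates both errors. *)
exists (maxn (2 * d) (Num.bound (A%:R * W * (2 * d)%:R / eps))) => N c.
rewrite gtn_max => /andP[Nd NB] [s [us <- sD]].
have N0 : (0 < N)%N by exact: leq_ltn_trans Nd.
have N0' : 0 < N%:R :> rat by rewrite ltr0n.
have Nd0 : 0 < N%:R ^+ d :> rat by rewrite exprn_gt0.
have up := points_upper triT ThP N0 us (fun x xs => (sD x).1 xs).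
(* The lower count is used at [N - 2 * d], so that its points lie in the dilate by [N]. *)
have NE : N = (N - 2 * d + 2 * d)%N by rewrite subnK // ltnW.
have low : (size (points_index T Th (N - 2 * d)) <= size s)%N.
  by apply: (points_lower triT zeroD ThP); rewrite -NE // => x /sD.
rewrite !size_points_index -/A in up low.
pose x : rat := (2 * d)%:R / N%:R.
have x01 : 0 <= x <= 1.
  by rewrite divr_ge0 //= ler_pdivrMr // mul1r ler_nat ltnW.
have xlt : A%:R * W * x < eps.
  rewrite /x mulrA ltr_pdivrMr // -ltr_pdivrMl // mulrC.
  by apply: lt_trans (archi_boundP B0) _; rewrite ltr_nat.
have upr : (d`!)%:R * (size s)%:R / N%:R ^+ d <= A%:R * (1 + x) ^+ d.
  rewrite ler_pdivrMr // -mulrA -exprMn.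
  have -> : (1 + x) * N%:R = (2 * d + N)%:R.
    by rewrite mulrDl mul1r mulfVK ?gt_eqF // natrD addrC.
  rewrite -natrX -!natrM ler_nat.
  apply: (leq_trans (leq_mul (leqnn d`!) up)); rewrite mulnCA leq_mul2l.
  apply/orP; right; apply: leq_trans (fact_binD_le d N) _; by apply: leq_pow; lia.
have lowr : A%:R * (1 - x) ^+ d <= (d`!)%:R * (size s)%:R / N%:R ^+ d.
  rewrite ler_pdivlMr // -mulrA -exprMn.
  have -> : (1 - x) * N%:R = (N - 2 * d)%:R.
    by rewrite mulrBl mul1r mulfVK ?gt_eqF // natrB // ltnW.
  rewrite -natrX -!natrM ler_nat.
  apply: leq_trans (leq_mul (leqnn d`!) low); rewrite mulnCA leq_mul2l.
  by rewrite fact_binD_ge orbT.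
have A0 : 0 <= A%:R :> rat by [].
have hi : A%:R * (1 + x) ^+ d <= A%:R + A%:R * W * x - A%:R * x.
  apply: le_trans (ler_wpM2l A0 (exp1D_le d x01)) _; rewrite -/W.
  by move: (A%:R) (W) (x) => a w y; lra.
have lo : A%:R - A%:R * (d%:R * x) <= A%:R * (1 - x) ^+ d.
  apply: le_trans _ (ler_wpM2l A0 (exp1B_ge d x01)).
  by move: (A%:R) (d%:R * x) => a y; lra.
have /andP[x0 _] := x01.
have dx : A%:R * (d%:R * x) <= A%:R * W * x by rewrite -mulrA ler_wpM2l // ler_wpM2r.
have Ax : 0 <= A%:R * x by rewrite mulr_ge0.
by rewrite ltr_norml; apply/andP; split; lra.
Qed.

(** * The generating function is the constant [Vol(Delta)] *)

Theorem theorem4p5 (d n : nat) (v : 'I_n -> 'rV[int]_d) (T : {set {set 'I_n}})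
    (f : forall k : nat, {ffun 'I_n * 'I_k.+1 -> nat} -> rat) :
  injective v ->
  reflexive_polytope v ->
  (forall i, ~ interior_pt (in_Delta v) (ratv (v i))) ->
  triangulation v T ->
  (forall k : nat, toric_integral (ray_k v (k := k)) (@cone_k n k T) (f k)) ->
  let coef (e : 'I_n -> int) : rat :=
    \sum_(J : {set 'I_n.+1} | #|J| == (d + 1)%N)
      ((Vol_J v J) ^+ 2)%:~R *
      Psi_coef v f (P_J v J) (fun i => e i - (lift ord0 i \in J)%:Z) in
  (forall e : 'I_n -> int, (exists i, e i != 0) -> coef e = 0) /\
  normalized_volume v (coef (fun _ => 0)).
Proof.
move=> _ [[eps eps0 zeroD] _] _ triT tf; split=> [e eN0|].
  exact: (coef_neq0 triT tf eN0).
change (normalized_volume v (coef v f (fun=> 0))); rewrite (coef_0 triT tf).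
apply: normalized_volume_triangulation => //; apply: zeroD => c.
by rewrite subrr normr0.
Qed.
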